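(* Let $n\ge 2$, let $\Omega\subset\mathbb{R}^n$ be a bounded open set with Lipschitz boundary, let $\beta>0$, and let $$\Lambda_\infty=\inf\Big\{\max\{\|\nabla w\|_{L^\infty(\Omega)},\ \beta\|w\|_{L^\infty(\partial\Omega)}\}\ :\ w\in W^{1,\infty}(\Omega),\ \|w\|_{L^\infty(\Omega)}=1\Big\}.$$ Then $$\Lambda_\infty=\min_{x_0\in\Omega}\frac{1}{\frac1\beta+d(x_0,\partial\Omega)}=\frac{1}{\frac1\beta+R_\Omega}.$$
   Context: $d(x,\partial\Omega)=\inf_{y\in\partial\Omega}|x-y|$ is the distance to the boundary and $R_\Omega=\sup_{x\in\Omega}d(x,\partial\Omega)$ is the inradius of $\Omega$. *)

(* Defs.v *)
From HB Require Import structures.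
From mathcomp Require Import all_boot all_order all_algebra.
From mathcomp Require Import all_classical all_reals all_analysis.

Set Implicit Arguments.
Unset Strict Implicit.
Unset Printing Implicit Defensive.

Import Order.TTheory GRing.Theory Num.Theory.
Import numFieldNormedType.Exports.

Local Open Scope classical_set_scope.
Local Open Scope ring_scope.

Definition rV_display : measure_display. Proof. exact. Qed.

Section measurable_rV.
Variables (R : realType) (n : nat).

Let coor (i : 'I_n) (v : 'rV[R]_n) : measurableTypeR R := v ord0 i.

Let rV_set0 : g_sigma_preimage coor set0.
Proof. exact: sigma_algebra0. Qed.

Let rV_setC A : g_sigma_preimage coor A -> g_sigma_preimage coor (~` A).
Proof. exact: sigma_algebraC. Qed.

Let rV_bigcup (F : (set 'rV[R]_n)^nat) :
  (forall i, g_sigma_preimage coor (F i)) ->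
  g_sigma_preimage coor (\bigcup_i (F i)).
Proof. exact: sigma_algebra_bigcup. Qed.

(* g_sigma_preimage coor is the Borel sigma-algebra. *)
HB.instance Definition _ := @isMeasurable.Build rV_display
  'rV[R]_n (g_sigma_preimage coor) rV_set0 rV_setC rV_bigcup.

Lemma measurable_coor (i : 'I_n) :
  measurable_fun [set: 'rV[R]_n] (fun v => v ord0 i : measurableTypeR R).
Proof.
move=> _ Y mY; rewrite setTI; apply: sub_sigma_algebra => /=.
rewrite -bigcup_seq/=; exists i => /=; first by rewrite mem_index_enum.
by exists Y => //; rewrite setTI.
Qed.

Lemma measurable_fun_rVP d (T : measurableType d) (f : T -> 'rV[R]_n) :
  (forall i, measurable_fun [set: T] (fun x => f x ord0 i : measurableTypeR R)) ->
  measurable_fun [set: T] f.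
Proof.
move=> mf _ Y mY; rewrite setTI.
suff : g_sigma_preimage (fun i => coor i \o f) `<=` measurable.
  by rewrite g_sigma_preimage_comp; apply; exists Y => //; rewrite setTI.
apply: smallest_sub; first exact: sigma_algebra_measurable.
rewrite -bigcup_seq; apply: bigcup_sub => i _ A [B mB <-].
exact: mf.
Qed.

End measurable_rV.

Section lebesgue_rV.
Variable R : realType.

Definition rV_cons n (p : measurableTypeR R * 'rV[R]_n) : 'rV[R]_n.+1 :=
  \row_(i < n.+1) if unlift ord0 i is Some j then p.2 ord0 j else p.1.

Definition rV_uncons n (v : 'rV[R]_n.+1) : measurableTypeR R * 'rV[R]_n :=
  (v ord0 ord0, \row_(j < n) v ord0 (lift ord0 j)).

Lemma rV_consK n : cancel (@rV_cons n) (@rV_uncons n).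
Proof.
move=> [a v]; rewrite /rV_uncons/rV_cons mxE unlift_none; congr pair.
by apply/rowP => j; rewrite !mxE liftK.
Qed.

Lemma measurable_rV_cons n : measurable_fun setT (@rV_cons n).
Proof.
apply: measurable_fun_rVP => i; rewrite /rV_cons.
under eq_fun do rewrite mxE.
case: unliftP => [j _|_]; last exact: measurable_fst.
apply: (@measurableT_comp _ _ _ _ _ _ (fun v : 'rV[R]_n => v ord0 j)) => //.
exact: measurable_coor.
Qed.

Lemma measurable_rV_uncons n : measurable_fun setT (@rV_uncons n).
Proof.
apply/measurable_fun_pairP; split => /=; first exact: measurable_coor.
apply: measurable_fun_rVP => i /=.
under eq_fun do rewrite mxE.
exact: measurable_coor.
Qed.

Section step.
Variables (n : nat) (m : {sigma_finite_measure set 'rV[R]_n -> \bar R}).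

Definition lebesgue_rV_step : set 'rV[R]_n.+1 -> \bar R :=
  pushforward (lebesgue_measure \x m)%E (@rV_cons n).

Let step0 : lebesgue_rV_step set0 = 0%E.
Proof. by rewrite /lebesgue_rV_step /pushforward preimage_set0 measure0. Qed.

Let step_ge0 A : (0 <= lebesgue_rV_step A)%E.
Proof. exact: (measure_ge0 (lebesgue_measure \x m)%E). Qed.

Let step_sigma_additive : semi_sigma_additive lebesgue_rV_step.
Proof.
move=> F mF tF mUF; rewrite /lebesgue_rV_step /pushforward preimage_bigcup.
have mc := @measurable_rV_cons n.
apply: measure_semi_sigma_additive.
- by move=> k; rewrite -[X in measurable X]setTI; exact: mc.
- apply/trivIsetP => /= i j _ _ ij; rewrite -preimage_setI.
  by move/trivIsetP : tF => /(_ _ _ _ _ ij) ->//; rewrite preimage_set0.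
- by rewrite -preimage_bigcup -[X in measurable X]setTI; exact: mc.
Qed.

HB.instance Definition _ := isMeasure.Build _ _ _
  lebesgue_rV_step step0 step_ge0 step_sigma_additive.

Let step_sigma_finite : sigma_finite setT lebesgue_rV_step.
Proof.
have /sigma_finiteP[F [TF ndF Foo]] := sigma_finiteT (@lebesgue_measure R).
have /sigma_finiteP[G [TG ndG Goo]] := sigma_finiteT m.
exists (fun k => @rV_uncons n @^-1` (F k `*` G k)).
  rewrite -preimage_bigcup (_ : \bigcup_k _ = setT) ?preimage_setT//.
  rewrite -setXTT TF TG predeqE => -[x y]; split.
    by move=> [k _ []/= ? ?]; split; exists k.
  move=> [/= [k _ Fkx] [l _ Gly]]; exists (maxn k l) => //; split.
  - by move: x Fkx; exact/subsetPset/ndF/leq_maxl.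
  - by move: y Gly; exact/subsetPset/ndG/leq_maxr.
move=> k; have [? ?] := Foo k; have [? ?] := Goo k; split.
  rewrite -[X in measurable X]setTI.
  by apply: measurable_rV_uncons => //; exact: measurableX.
rewrite /lebesgue_rV_step /pushforward.
rewrite (_ : _ @^-1` _ = F k `*` G k).
  by rewrite product_measure1E// lte_mul_pinfty// ge0_fin_numE.
by apply/funext => p; rewrite /preimage /mkset rV_consK.
Qed.

HB.instance Definition _ := @Measure_isSigmaFinite.Build _ _ _
  lebesgue_rV_step step_sigma_finite.

End step.

Fixpoint lebesgue_rV (n : nat) : {sigma_finite_measure set 'rV[R]_n -> \bar R} :=
  match n with
  | 0%N => dirac (0 : 'rV[R]_0)
  | m.+1 => lebesgue_rV_step (lebesgue_rV m)
  end.

Lemma lebesgue_rV_box n (a b : 'rV[R]_n) : (forall i, a ord0 i <= b ord0 i) ->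
  lebesgue_rV n [set v | forall i, a ord0 i <= v ord0 i <= b ord0 i] =
  (\prod_(i < n) (b ord0 i - a ord0 i))%:E.
Proof.
elim: n => [|n IH] in a b * => ab.
  rewrite big_ord0 /= diracE mem_set//; by move=> [].
rewrite big_ord_recl /= /lebesgue_rV_step /pushforward.
set a' := (rV_uncons a).2; set b' := (rV_uncons b).2.
set B := [set v : 'rV[R]_n | forall i, a' ord0 i <= v ord0 i <= b' ord0 i].
have mB : measurable B.
  rewrite (_ : B = \bigcap_(i in [set: 'I_n])
     ((fun v : 'rV[R]_n => v ord0 i : measurableTypeR R)
         @^-1` `[a' ord0 i, b' ord0 i])).
    apply: fin_bigcap_measurable => // i _; rewrite -[X in measurable X]setTI.
    by apply: measurable_coor => //; exact: measurable_itv.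
  apply/seteqP; split => v /= H i; first by move=> _ /=; rewrite in_itv/=.
  by have := H i I; rewrite /= in_itv.
rewrite (_ : _ @^-1` _ =
    (`[a ord0 ord0, b ord0 ord0] : set (measurableTypeR R)) `*` B).
  rewrite product_measure1E//.
  transitivity (@lebesgue_measure R `[a ord0 ord0, b ord0 ord0] * lebesgue_rV n B)%E => //.
  rewrite lebesgue_measure_itv/= lte_fin IH; last by move=> i; rewrite !mxE.
  have -> : (if a ord0 ord0 < b ord0 ord0
      then ((b ord0 ord0)%:E - (a ord0 ord0)%:E)%E else 0%E) =
     (b ord0 ord0 - a ord0 ord0)%:E.
    case: ifPn => // /negP/negP; rewrite -leNgt => ba.
    have /eqP-> : b ord0 ord0 == a ord0 ord0 by rewrite eq_le ba ab.
    by rewrite subrr.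
  rewrite -EFinM; congr (_ * _)%:E.
  by apply: eq_bigr => i _; rewrite !mxE.
apply/seteqP; split => [[t v]|[t v]] /=.
- move=> H; split => /=.
    by rewrite in_itv/=; have := H ord0; rewrite !mxE unlift_none.
  by move=> i; have := H (lift ord0 i); rewrite !mxE liftK.
- move=> [/= + H] i; rewrite in_itv/= => tab; rewrite !mxE.
  by case: unliftP => [j ->|->] //; have := H j; rewrite !mxE.
Qed.

End lebesgue_rV.

Section euclidean.
Variables (R : realType) (n : nat).
Implicit Types (x y : 'rV[R]_n) (A Omega : set 'rV[R]_n).

Definition dotp x y : R := \sum_(i < n) x ord0 i * y ord0 i.

(* The library norm [`|x|] on row vectors is the maximum norm (it induces the
   same topology and the same bounded sets); lengths and distances below are
   Euclidean. *)
Definition enorm x : R := Num.sqrt (dotp x x).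

Definition boundary A : set 'rV[R]_n := closure A `\` A°.

Definition bdist Omega x : R := inf [set enorm (x - y) | y in boundary Omega].

Definition inradius Omega : R := sup [set bdist Omega x | x in Omega].

(* Near each boundary point, Omega is the region strictly above the graph of a
   Lipschitz function, in the direction of a unit vector e.  The graph lives
   over the hyperplane orthogonal to e, so gamma is only evaluated at the
   orthogonal projections [y - dotp y e *: e]; asking for it on the whole space
   is no restriction, as one can compose with this projection. *)
Definition lipschitz_boundary Omega : Prop :=
  forall x, boundary Omega x ->
  exists r k (e : 'rV[R]_n) (gamma : 'rV[R]_n -> R),
    [/\ 0 < r, enorm e = 1,
        forall u v, `|gamma u - gamma v| <= k * enorm (u - v) &
        forall y, enorm (y - x) < r ->
          (Omega y <-> gamma (y - dotp y e *: e) < dotp y e)].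

End euclidean.

Section hausdorff.
Variables (R : realType) (n : nat).
Implicit Types A U : set 'rV[R]_n.
Local Open Scope ereal_scope.

(* The maximum with 0 only matters for the empty set. *)
Definition ediam U : \bar R :=
  maxe 0 (ereal_sup [set (enorm (x - y))%:E | x in U & y in U]).

(* Integer dimension s >= 1, without the usual normalizing constant. *)
Definition hausdorff_pre (s : nat) (delta : R) A : \bar R :=
  ereal_inf [set \sum_(k <oo) (ediam (F k)) ^+ s | F in
    [set F : (set 'rV[R]_n)^nat |
      A `<=` \bigcup_k F k /\ forall k, ediam (F k) <= delta%:E]].

Definition hausdorff (s : nat) A : \bar R :=
  ereal_sup [set hausdorff_pre s delta A | delta in [set delta : R | (0 < delta)%R]].

End hausdorff.

Section sobolev.
Variables (R : realType) (n : nat).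
Implicit Types (Omega : set 'rV[R]_n) (w phi u T : 'rV[R]_n -> R).
Implicit Types (G : 'rV[R]_n -> 'rV[R]_n).

Definition Linfty_norm Omega w : \bar R :=
  ('N[lebesgue_rV R n]_+oo [EFin \o (w \_ Omega)])%E.

Definition Linfty Omega w : Prop :=
  measurable_fun Omega w /\ (Linfty_norm Omega w < +oo)%E.

(* Essential supremum for the (n-1)-dimensional Hausdorff measure; only its null
   sets matter, so the normalization is irrelevant. *)
Definition Linfty_norm_boundary Omega T : \bar R :=
  ereal_inf [set M%:E | M in [set M : R | 0 <= M /\
    hausdorff n.-1 (boundary Omega `&` [set x | M < `|T x|]) = 0%E]].

Definition partial (i : 'I_n) phi : 'rV[R]_n -> R := 'D_(delta_mx ord0 i) phi.

Definition iter_partial (s : seq 'I_n) phi := foldr partial phi s.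

Definition smooth phi : Prop := forall s : seq 'I_n,
  continuous (iter_partial s phi) /\
  forall i x, derivable (iter_partial s phi) x (delta_mx ord0 i).

Definition test_function Omega phi : Prop :=
  let supp := closure [set x | phi x != 0] in
  [/\ smooth phi, compact supp & supp `<=` Omega].

Definition is_weak_gradient Omega w G : Prop :=
  forall (i : 'I_n) phi, test_function Omega phi ->
  \int[lebesgue_rV R n]_(x in Omega) (w x * partial i phi x) =
  - \int[lebesgue_rV R n]_(x in Omega) (G x ord0 i * phi x).

(* [w] belongs to W^{1,oo}(Omega) and its weak gradient is [G]. *)
Definition W1infty Omega w G : Prop :=
  [/\ Linfty Omega w,
      forall i, Linfty Omega (fun x => G x ord0 i) &
      is_weak_gradient Omega w G].

(* On a bounded Lipschitz domain a function of W^{1,oo} has a representative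
   that is continuous up to the boundary; its trace is the restriction of this
   representative to the boundary. *)
Definition is_trace Omega w T : Prop :=
  exists u, [/\ {within closure Omega, continuous u},
    {ae lebesgue_rV R n, forall x, Omega x -> u x = w x} &
    forall x, boundary Omega x -> T x = u x].

Definition Lambda_infty Omega (beta : R) : \bar R :=
  ereal_inf [set l | exists w G T,
    [/\ W1infty Omega w G, is_trace Omega w T, Linfty_norm Omega w = 1%E &
        l = maxe (Linfty_norm Omega (fun x => enorm (G x)))
                 (beta%:E * Linfty_norm_boundary Omega T)%E]].

End sobolev.

Definition is_minimum (R : realType) (A : set R) (m : R) : Prop :=
  A m /\ lbound A m.

(* Main.v *)
Require Import Defs.
From mathcomp Require Import all_boot all_order all_algebra.
From mathcomp Require Import all_classical all_reals all_analysis.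
From mathcomp Require Import measurable_realfun ess_sup_inf ring lra.

Import Order.TTheory GRing.Theory Num.Theory.
Import numFieldNormedType.Exports.

Local Open Scope classical_set_scope.
Local Open Scope ring_scope.
Set Implicit Arguments.
Unset Strict Implicit.
Unset Printing Implicit Defensive.

(* Lower bound.  Let (w, G) be admissible with energy at most L.  Mollifying w with
   smooth bumps moved along a segment of Omega and differentiating in the
   displacement shows that the continuous representative u of w is L-Lipschitz
   along that segment.  The trace is bounded by L / beta up to a set of null
   Hausdorff measure, hence everywhere on the boundary, because a relatively open
   piece of a Lipschitz boundary projects onto an open subset of a hyperplane and
   so is not null.  Following the segment from x to a nearest boundary point gives
   |u x| <= L / beta + L d(x) <= L (1 / beta + R), while sup |u| = 1.

   Upper bound.  At an incentre x0, where d(x0) = R, normalize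
   1 / beta + max (0, R - |x - x0|), whose gradient has norm at most 1 and which
   equals 1 / beta on the boundary.  This cone is replaced by smooth approximations,
   for which the weak gradient is the classical one. *)

(** * Euclidean norm and distance to the boundary *)

(** A weak gradient can be probed only by test functions supported in [Omega], so explicit ones are
    built: products of one-variable bumps made from exp(-1/t). Their supports are cubes, that is
    balls of the maximum norm, which is why tubes around segments are measured in that norm while
    lengths are Euclidean. A tube of positive width fits inside [Omega] only if the segment stops
    before the boundary; the missing piece is supplied by the continuity of [u] up to the boundary.
    The bumps are not normalized: their mass is constant along the segment and cancels at the end.

    For the upper bound, the exact cone is not differentiable at its vertex and along the sphere
    where it is cut off. Smoothing it at scale [e] costs an error of order [e] in the energy, so the
    value is approached only as [e] tends to 0, which is enough for an infimum. *)

Section enorm_theory.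
Context {R : realType} {n : nat}.
Implicit Types (x y z : 'rV[R]_n) (a : R).

Lemma dotpC x y : dotp x y = dotp y x.
Proof. by apply: eq_bigr => i _; rewrite mulrC. Qed.

Lemma dotpDl x y z : dotp (x + y) z = dotp x z + dotp y z.
Proof. by rewrite -big_split; apply: eq_bigr => i _; rewrite mxE mulrDl. Qed.

Lemma dotpDr x y z : dotp z (x + y) = dotp z x + dotp z y.
Proof. by rewrite !(dotpC z) dotpDl. Qed.

Lemma dotpZl a x y : dotp (a *: x) y = a * dotp x y.
Proof. by rewrite /dotp mulr_sumr; apply: eq_bigr => i _; rewrite mxE mulrA. Qed.

Lemma dotpZr a x y : dotp x (a *: y) = a * dotp x y.
Proof. by rewrite !(dotpC x) dotpZl. Qed.

Lemma dotpNl x y : dotp (- x) y = - dotp x y.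
Proof. by rewrite -scaleN1r dotpZl mulN1r. Qed.

Lemma dotpBl x y z : dotp (x - y) z = dotp x z - dotp y z.
Proof. by rewrite dotpDl dotpNl. Qed.

Lemma dotp_ge0 x : 0 <= dotp x x.
Proof. by apply: sumr_ge0 => i _; rewrite -expr2 sqr_ge0. Qed.

Lemma enorm_ge0 x : 0 <= enorm x.
Proof. exact: sqrtr_ge0. Qed.

Lemma enorm_sqr x : enorm x ^+ 2 = dotp x x.
Proof. exact/sqr_sqrtr/dotp_ge0. Qed.

Lemma enorm0 : enorm (0 : 'rV[R]_n) = 0.
Proof.
by rewrite /enorm /dotp big1 ?sqrtr0// => i _; rewrite mxE mul0r.
Qed.

Lemma enormZ a x : enorm (a *: x) = `|a| * enorm x.
Proof.
by rewrite /enorm dotpZl dotpZr mulrA -expr2 sqrtrM ?sqr_ge0// sqrtr_sqr.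
Qed.

Lemma enormN x : enorm (- x) = enorm x.
Proof. by rewrite -scaleN1r enormZ normrN normr1 mul1r. Qed.

Lemma enormB x y : enorm (x - y) = enorm (y - x).
Proof. by rewrite -enormN opprB. Qed.

Lemma coord_le_enorm x i : `|x ord0 i| <= enorm x.
Proof.
rewrite -sqrtr_sqr ler_wsqrtr// /dotp (bigD1 i)//= -expr2 lerDl.
by apply: sumr_ge0 => j _; rewrite -expr2 sqr_ge0.
Qed.

Lemma coord_le_norm x i : `|x ord0 i| <= `|x|.
Proof. by rewrite [leRHS]/Num.norm/= mx_normrE; apply: (le_bigmax _ _ (ord0, i)). Qed.

Lemma norm_le_enorm x : `|x| <= enorm x.
Proof.
rewrite [leLHS]/Num.norm/= mx_normrE; apply: bigmax_le => [|[i j] _ /=].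
  exact: enorm_ge0.
by rewrite ord1 coord_le_enorm.
Qed.

Lemma enorm_eq0 x : enorm x = 0 -> x = 0.
Proof.
by move=> x0; apply/normr0_eq0/le_anti; rewrite normr_ge0 -x0 norm_le_enorm.
Qed.

(** The crude constant [n], in place of its square root, suffices: the comparison only turns
    smallness or boundedness in the maximum norm into the Euclidean one. *)
Lemma enorm_le_norm x : enorm x <= n%:R * `|x|.
Proof.
have n0 : 0 <= n%:R * `|x| by rewrite mulr_ge0.
rewrite -(ler_pXn2r (n := 2))// ?nnegrE ?enorm_ge0// enorm_sqr /dotp.
apply: (@le_trans _ _ (\sum_(i < n) `|x| ^+ 2)).
  apply: ler_sum => i _; rewrite -expr2 -real_normK ?num_real//.
  by rewrite ler_pXn2r ?nnegrE// coord_le_norm.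
rewrite sumr_const card_ord -[leLHS]mulr_natl exprMn ler_wpM2r ?sqr_ge0// -natrX ler_nat.
by case: (n) => // m; rewrite expnS expn1 leq_pmull.
Qed.

(** Cauchy-Schwarz: the square of [dotp y y *: x - dotp x y *: y] is nonnegative and equals
    [dotp y y] times the defect of the squared inequality. *)
Lemma dotp_le_enorm x y : `|dotp x y| <= enorm x * enorm y.
Proof.
have [y0|y0] := eqVneq (enorm y) 0.
  rewrite y0 mulr0 (enorm_eq0 y0) /dotp big1 ?normr0// => i _.
  by rewrite mxE mulr0.
have yy : 0 < dotp y y by rewrite -enorm_sqr exprn_gt0// lt_def y0 enorm_ge0.
rewrite -(ler_pXn2r (n := 2)) ?nnegrE ?mulr_ge0 ?enorm_ge0//.
rewrite exprMn !enorm_sqr real_normK ?num_real// -subr_ge0 -(pmulr_rge0 _ yy).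
have := dotp_ge0 (dotp y y *: x - dotp x y *: y).
rewrite !(dotpDl, dotpDr, dotpNl, dotpZl, dotpZr) -scaleNr !(dotpZl, dotpZr).
by rewrite (dotpC y x) => /le_trans; apply; rewrite le_eqVlt; apply/orP; left; apply/eqP;
  ring.
Qed.

Lemma ler_enormD x y : enorm (x + y) <= enorm x + enorm y.
Proof.
rewrite -(ler_pXn2r (n := 2)) ?nnegrE ?addr_ge0 ?enorm_ge0//.
rewrite sqrrD !enorm_sqr !(dotpDl, dotpDr) (dotpC y x).
have := le_trans (ler_norm _) (dotp_le_enorm x y).
lra.
Qed.

Lemma ler_enorm_dist x y : `|enorm x - enorm y| <= enorm (x - y).
Proof.
have := ler_enormD (x - y) y; have := ler_enormD (y - x) x.
rewrite !subrK (enormB y) => h1 h2.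
by rewrite ler_norml; apply/andP; split; lra.
Qed.

Lemma lipschitz_continuous (f : 'rV[R]_n -> R) (C : R) :
  (forall x y, `|f x - f y| <= C * enorm (x - y)) -> continuous f.
Proof.
move=> lf x s /= /(nbhs_ballP (f x)) [e /= e0 es].
(* The two successors keep the divisor positive whatever the sign of [C] and even if [n] is 0. *)
have C0 : 0 < (`|C| + 1) * n.+1%:R :> R by rewrite mulr_gt0// ltr_wpDl.
apply/nbhs_ballP; exists (e / ((`|C| + 1) * n.+1%:R)); first exact: divr_gt0.
move=> y; rewrite -ball_normE /= ltr_pdivlMr// => xy.
apply: es; rewrite -ball_normE /=; apply: le_lt_trans xy.
apply: le_trans (lf x y) _; apply: le_trans (ler_norm _) _.
rewrite normrM (ger0_norm (enorm_ge0 _)) mulrCA.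
apply: ler_pM; rewrite ?enorm_ge0// ?lerDl//.
apply: le_trans (enorm_le_norm _) _.
by rewrite mulrC ler_wpM2l// ler_nat.
Qed.

End enorm_theory.

Section boundary_theory.
Context {R : realType} {n : nat}.
Variable Omega : set 'rV[R]_n.
Hypothesis Omega_open : open Omega.
Implicit Types x y z : 'rV[R]_n.

Lemma boundaryE : boundary Omega = closure Omega `\` Omega.
Proof. by rewrite /boundary (interior_id _).1. Qed.

Lemma closed_boundary : closed (boundary Omega).
Proof.
by rewrite boundaryE setDE; apply: closedI; [exact: closed_closure|exact: open_closedC].
Qed.

(** By connectedness: on a segment that misses the boundary, the parameters of points of [Omega] are
    also those of points of [closure Omega], so they form a set both open and closed. *)
Lemma segment_meets_boundary x y : Omega x -> ~ Omega y ->
  exists t : R, 0 <= t <= 1 /\ boundary Omega (x + t *: (y - x)).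
Proof.
move=> Ox nOy; apply: contrapT => nb.
pose g (t : R) := x + t *: (y - x).
have cg : continuous g.
  move=> t; apply: cvgD; first exact: cvg_cst.
  by apply: cvgZr_tmp; exact: cvg_id.
pose I01 := [set` `[(0 : R), 1]].
suff E : I01 `&` g @^-1` Omega = I01.
  apply: nOy; have : I01 1 by rewrite /I01/= in_itv/= lexx ler01.
  by rewrite -E => -[_]; rewrite /= /g scale1r addrC subrK.
apply: (@segment_connected R 0 1).
- by exists 0; split; rewrite /I01 /= ?in_itv/= ?lexx ?ler01// /g scale0r addr0.
- by exists (g @^-1` Omega) => //; apply: open_comp => // t _; exact: cg.
- exists (g @^-1` closure Omega).
    by apply: preimage_closed => [t _|]; [exact: cg|exact: closed_closure].
  apply/seteqP; split => t [] t01 Og; split => //; first exact: subset_closure.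
  apply: contrapT => nO; apply: nb; exists t; split; first by move: t01; rewrite /= in_itv.
  by rewrite boundaryE.
Qed.

Hypothesis Omega_bounded : bounded_set Omega.

Lemma bounded_closure : bounded_set (closure Omega).
Proof.
move: Omega_bounded => [M [Mr h]]; exists M; split => // N MN x /=.
have cl : closed [set y : 'rV[R]_n | `|y| <= N].
  by rewrite (_ : mkset _ = Num.norm @^-1` [set t | t <= N])//;
    apply: preimage_closed => [? _|]; [exact: norm_continuous|exact: closed_le].
by move=> /(closureS (h N MN)); rewrite -(closure_id _).1.
Qed.

Lemma compact_closure : compact (closure Omega).
Proof. exact/bounded_closed_compact/closed_closure/bounded_closure. Qed.

Lemma compact_boundary : compact (boundary Omega).
Proof.
apply: subclosed_compact closed_boundary compact_closure _.
by move=> x [].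
Qed.

Hypothesis Omega0 : Omega !=set0.
Hypothesis n_gt0 : (0 < n)%N.

(** A segment towards a point beyond the bound of [Omega] has to leave [Omega]. Such a point needs a
    coordinate, hence a positive dimension. *)
Lemma boundary_neq0 : boundary Omega !=set0.
Proof.
have [x Ox] := Omega0.
have [M [_ /(_ (`|M| + 1))h]] := Omega_bounded.
have {h} hM y : Omega y -> `|y| <= `|M| + 1.
  by apply: h; rewrite ltr_pwDr// ler_norm.
have [|t [_ ?]] := @segment_meets_boundary x (const_mx (`|M| + 2)) Ox; last by eexists;
  eassumption.
move/hM; apply/negP; rewrite -ltNge.
have := coord_le_norm (const_mx (`|M| + 2)) (Ordinal n_gt0).
rewrite mxE; apply: lt_le_trans; rewrite [ltRHS]ger0_norm ?addr_ge0//.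
by rewrite ltrD2l ltr1n.
Qed.

Lemma bdist_le x y : boundary Omega y -> bdist Omega x <= enorm (x - y).
Proof.
move=> by_; apply: ge_inf; last by exists y.
by exists 0 => _ [z _ <-]; exact: enorm_ge0.
Qed.

Lemma bdist_attained x :
  exists2 y, boundary Omega y & bdist Omega x = enorm (x - y).
Proof.
have [|y] := @EVT_min_rV R n (fun y => enorm (x - y)) _ boundary_neq0 compact_boundary;
  last first.
  rewrite inE => bdy ymin; exists y => //; apply/le_anti; rewrite bdist_le//=.
  apply: lb_le_inf => [|_ [z bz <-]]; first by have [z ?] := boundary_neq0;
    exists (enorm (x - z)), z.
  by apply: ymin; rewrite inE.
apply/continuous_subspaceT/(@lipschitz_continuous _ _ _ 1) => y z; rewrite mul1r.
apply: le_trans (ler_enorm_dist _ _) _.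
by rewrite opprB addrC addrA subrK (enormB y).
Qed.

Lemma bdist_ge0 x : 0 <= bdist Omega x.
Proof. by have [y _ ->] := bdist_attained x; exact: enorm_ge0. Qed.

Lemma bdist_gt0 x : Omega x -> 0 < bdist Omega x.
Proof.
move=> Ox; have [y bdy E] := bdist_attained x.
rewrite lt_def bdist_ge0 andbT; apply: contraPN Ox => /eqP; rewrite E => /enorm_eq0/eqP.
by rewrite subr_eq0 => /eqP ->; move: bdy; rewrite boundaryE => -[].
Qed.

Lemma bdist_boundary x : boundary Omega x -> bdist Omega x = 0.
Proof.
by move=> bx; apply/le_anti; rewrite bdist_ge0 andbT -(@enorm0 R n) -(subrr x) bdist_le.
Qed.

Lemma bdist_lipschitz x y : bdist Omega x <= bdist Omega y + enorm (x - y).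
Proof.
have [z bz ->] := bdist_attained y; apply: le_trans (bdist_le x bz) _.
by have := ler_enormD (y - z) (x - y); rewrite [_ + (x - y)]addrC addrA subrK.
Qed.

Lemma continuous_bdist : continuous (bdist Omega).
Proof.
apply: (@lipschitz_continuous _ _ _ 1) => x y; rewrite mul1r.
have := bdist_lipschitz x y; have := bdist_lipschitz y x; rewrite (enormB y).
by move=> h1 h2; rewrite ler_norml; apply/andP; split; lra.
Qed.

(** The distance is maximized over the compact closure; the maximizer lies in [Omega] because the
    distance vanishes on the boundary and is positive somewhere. *)
Lemma inradius_attained :
  exists2 x, Omega x & bdist Omega x = inradius Omega.
Proof.
have [||x] := @EVT_max_rV R n (bdist Omega) (closure Omega) _ compact_closure.
- by have [x Ox] := Omega0; exists x; exact: subset_closure.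
- exact/continuous_subspaceT/continuous_bdist.
rewrite inE => clx xmax.
have ub y : Omega y -> bdist Omega y <= bdist Omega x.
  by move=> Oy; apply: xmax; rewrite inE; exact: subset_closure.
have Ox : Omega x.
  apply: contrapT => nOx; have [z Oz] := Omega0.
  have /(lt_le_trans (bdist_gt0 Oz)) := ub z Oz.
  by rewrite bdist_boundary ?ltxx// boundaryE.
exists x => //; apply/le_anti/andP; split.
  apply: ub_le_sup; last by exists x.
  by exists (bdist Omega x) => _ [y Oy <-]; exact: ub.
apply: ge_sup => [|_ [y Oy <-]]; last exact: ub.
by exists (bdist Omega x), x.
Qed.

(** The content is that the distances are bounded above, without which [sup] would not be an upper
    bound; a fixed boundary point [z] provides the bound. *)
Lemma bdist_le_inradius x : Omega x -> bdist Omega x <= inradius Omega.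
Proof.
move=> Ox; apply: ub_le_sup; last by exists x.
have [M [_ /(_ (`|M| + 1))h]] := Omega_bounded.
have {h} hM y : Omega y -> `|y| <= `|M| + 1.
  by apply: h; rewrite ltr_pwDr// ler_norm.
have [z bz] := boundary_neq0.
exists (n%:R * (`|M| + 1 + `|z|)) => _ [y Oy <-].
apply: le_trans (bdist_le y bz) _; apply: le_trans (enorm_le_norm _) _.
by rewrite ler_wpM2l//; apply: le_trans (ler_normB _ _) _; rewrite lerD2r hM.
Qed.

(** Otherwise the segment from [x] to [y] would cross the boundary at a point closer to [x] than the
    boundary is. *)
Lemma bdist_ball x y : Omega x -> enorm (y - x) < bdist Omega x -> Omega y.
Proof.
move=> Ox yx; apply: contrapT => nOy.
have [t [/andP[t0 t1] bt]] := segment_meets_boundary Ox nOy.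
have := bdist_le x bt; apply/negP; rewrite -ltNge.
rewrite opprD addNKr -scaleNr enormZ normrN (ger0_norm t0).
by apply: le_lt_trans yx; rewrite ler_piMl// enorm_ge0.
Qed.

End boundary_theory.

(** * Lebesgue measure and integration by parts *)

Section measurable_rV_open.
Context {R : realType} {n : nat}.

Lemma measurable_rV_box (a b : 'rV[R]_n) :
  measurable [set v : 'rV[R]_n | forall i, a ord0 i <= v ord0 i <= b ord0 i].
Proof.
rewrite (_ : mkset _ = \bigcap_(i in [set: 'I_n])
    ((fun v : 'rV[R]_n => v ord0 i : measurableTypeR R)
       @^-1` `[a ord0 i, b ord0 i])).
  apply: fin_bigcap_measurable => // i _; rewrite -[X in measurable X]setTI.
  by apply: measurable_coor => //; exact: measurable_itv.
apply/seteqP; split => v /= H i; first by move=> _ /=; rewrite in_itv/=.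
by have := H i I; rewrite /= in_itv.
Qed.

(** The sigma-algebra is generated by the coordinates, so it contains the boxes with rational
    corners, and an open set is the countable union of those that it contains. *)
Lemma open_measurable_rV (U : set 'rV[R]_n) : open U -> measurable U.
Proof.
move=> oU.
pose B (p : 'rV[rat]_n * 'rV[rat]_n) := [set v : 'rV[R]_n |
  forall i, ratr (p.1 ord0 i) <= v ord0 i <= ratr (p.2 ord0 i)].
pose F p := if pselect (B p `<=` U) then B p else set0.
have -> : U = \bigcup_p F p.
  apply/seteqP; split => [x Ux|x [p _]]; last first.
    by rewrite /F; case: pselect => // BU; exact: BU.
  have [e /= e0 eU] := (nbhs_ballP x U).1 (open_nbhs_nbhs (conj oU Ux)).
  have /all_sig[q hq] (i : 'I_n) :
      {q : rat * rat | x ord0 i - e < ratr q.1 <= x ord0 i /\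
                       x ord0 i <= ratr q.2 < x ord0 i + e}.
    apply: cid.
    have [q1] := @rat_in_itvoo R (x ord0 i - e) (x ord0 i) ltac:(by rewrite ltrBlDr ltrDl).
    have [q2] := @rat_in_itvoo R (x ord0 i) (x ord0 i + e) ltac:(by rewrite ltrDl).
    rewrite !in_itv/= => /andP[h1 h2] /andP[h3 h4].
    by exists (q1, q2) => /=; rewrite h2 h3 !ltW.
  exists (\row_i (q i).1, \row_i (q i).2) => //.
  rewrite /F; case: pselect => [BU i|]; first by rewrite !mxE;
    have [/andP[_ ->] /andP[-> _]] := hq i.
  case => v Bv; apply: eU; split => // i j; rewrite ord1.
  have := Bv j; rewrite !mxE => /andP[l1 l2].
  have [/andP[l3 l4] /andP[l5 l6]] := hq j.
  rewrite -ball_normE /= ltr_distl; apply/andP; split; lra.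
apply: countable_bigcupT_measurable => // p.
rewrite /F; case: pselect => [BU|nBU] //=.
have := measurable_rV_box (\row_i ratr (p.1 ord0 i)) (\row_i ratr (p.2 ord0 i)).
by congr measurable; apply/seteqP; split => v /= h i; have := h i; rewrite !mxE.
Qed.

Lemma open_continuous_measurable_rV (U : set 'rV[R]_n) (f : 'rV[R]_n -> R) :
  open U -> (forall x, U x -> {for x, continuous f}) -> measurable_fun U f.
Proof.
move=> oU cf; apply: (measurability _ (RGenOpens.measurableE R)).
move=> _ [_ [a [b ->] <-]]; apply: open_measurable_rV.
rewrite openE => x [Ux fx]; rewrite /interior.
apply: filterI; first exact: open_nbhs_nbhs.
by apply: cf => //; apply: open_nbhs_nbhs; split => //; exact: interval_open.
Qed.

Lemma continuous_measurable_rV (f : 'rV[R]_n -> R) :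
  continuous f -> measurable_fun setT f.
Proof. by move=> cf; apply: open_continuous_measurable_rV => [|x _];
  [exact: openT|exact: cf]. Qed.

End measurable_rV_open.

(** Both difference quotients are the same function of the increment. Directional derivatives are
    thereby computed with one-variable calculus. *)
Lemma is_derive_line (R : realType) (n : nat) (f : 'rV[R]_n -> R) x v t d :
  is_derive (x + t *: v) v f d <-> is_derive t 1 (fun s => f (x + s *: v)) d.
Proof.
have E : (fun h => h^-1 *: ((f \o shift (x + t *: v)) (h *: v) - f (x + t *: v))) =
         (fun h => h^-1 *: (((fun s => f (x + s *: v)) \o shift t) (h *: 1) - f (x + t *:
           v))).
  by apply/funext => h /=; rewrite [h *: 1]mulr1 scalerDl addrCA.
by split => -[d1 d2]; constructor; move: d1 d2; rewrite /derivable /derive E.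
Qed.

Section bounded_measure.
Context {R : realType} {n : nat}.
Local Notation mu := (lebesgue_rV R n).

Lemma lebesgue_rV_bounded_lty (A : set 'rV[R]_n) :
  measurable A -> bounded_set A -> (mu A < +oo)%E.
Proof.
move=> mA [M [_ /(_ (`|M| + 1))h]].
have {}h x : A x -> `|x| <= `|M| + 1 by apply: h; rewrite ltr_pwDr// ler_norm.
pose c : 'rV[R]_n := const_mx (`|M| + 1).
apply: (@le_lt_trans _ _ (mu [set v | forall i, (- c) ord0 i <= v ord0 i <= c ord0 i])).
  apply: le_measure; rewrite ?inE//; first exact: measurable_rV_box.
  move=> x Ax i; rewrite !mxE -ler_norml; apply: le_trans (h x Ax).
  exact: coord_le_norm.
by rewrite lebesgue_rV_box ?ltry// => i; rewrite !mxE -subr_ge0 opprK addr_ge0// addr_ge0.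
Qed.

Lemma lebesgue_rV_open_gt0 (U : set 'rV[R]_n) :
  open U -> U !=set0 -> (0 < mu U)%E.
Proof.
move=> oU [x Ux]; have [e /= e0 eU] := (nbhs_ballP x U).1 (open_nbhs_nbhs (conj oU Ux)).
have e2 : 0 < e / 2 by rewrite divr_gt0.
pose c : 'rV[R]_n := const_mx (e / 2).
apply: (@lt_le_trans _ _ (mu [set v | forall i, (x - c) ord0 i <= v ord0 i <= (x + c) ord0
  i])).
  rewrite lebesgue_rV_box => [|i]; last by rewrite !mxE lerBlDr -addrA lerDl addr_ge0 ?ltW.
  rewrite lte_fin; apply: prodr_gt0 => i _; rewrite !mxE; lra.
apply: le_measure; rewrite ?inE//; first exact: measurable_rV_box.
  exact: open_measurable_rV.
move=> v h; apply: eU; split => // i j; rewrite ord1.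
have := h j; rewrite !mxE -ball_normE /= ltr_distl => /andP[h1 h2].
apply/andP; split; lra.
Qed.

End bounded_measure.

(** * Vanishing integral of a compactly supported partial derivative *)

Section integral_partial.
Context {R : realType}.

Lemma norm_rV_cons_ge n (t : R) (v : 'rV[R]_n) :
  `|t| <= `|rV_cons (t, v)| /\ `|v| <= `|rV_cons (t, v)|.
Proof.
split.
  by have := coord_le_norm (rV_cons (t, v)) ord0; rewrite mxE unlift_none.
rewrite [leLHS]/Num.norm/= mx_normrE; apply: bigmax_le => // -[i j] _ /=; rewrite ord1.
by have := coord_le_norm (rV_cons (t, v)) (lift ord0 j); rewrite mxE liftK.
Qed.

Lemma rV_cons_shift0 n (t s : R) (v : 'rV[R]_n) :
  rV_cons (t, v) + s *: delta_mx ord0 ord0 = rV_cons (t + s, v).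
Proof.
apply/rowP => i; rewrite !mxE; case: unliftP => [j ->|->] /=.
  by rewrite mulr0 addr0.
by rewrite mulr1.
Qed.

Lemma rV_cons_shift n (t s : R) (v : 'rV[R]_n) j :
  rV_cons (t, v) + s *: delta_mx ord0 (lift ord0 j) =
  rV_cons (t, v + s *: delta_mx ord0 j).
Proof.
apply/rowP => i; rewrite !mxE; case: unliftP => [k ->|->] /=.
  by rewrite !mxE /= (inj_eq lift_inj).
by rewrite mulr0 addr0.
Qed.

Lemma continuous_rV_cons1 n (f : 'rV[R]_n.+1 -> R) (v : 'rV[R]_n) :
  continuous f -> continuous (fun t : R => f (rV_cons (t, v))).
Proof.
move=> cf t s fs; have := cf _ _ fs => /nbhs_ballP[e /= e0 es].
apply/nbhs_ballP; exists e => //= u tu; apply: es; split => // i j.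
by rewrite !mxE; case: unliftP => [k _|_] //=; exact: ballxx.
Qed.

Lemma continuous_rV_cons2 n (f : 'rV[R]_n.+1 -> R) (t : R) :
  continuous f -> continuous (fun v : 'rV[R]_n => f (rV_cons (t, v))).
Proof.
move=> cf v s fs; have := cf _ _ fs => /nbhs_ballP[e /= e0 es].
apply/nbhs_ballP; exists e => //= u [_ tu]; apply: es; split => // i j.
by rewrite !mxE; case: unliftP => [k _|_] //=; exact: ballxx.
Qed.

Lemma integral_line_eq0 (g g' : R -> R) (M : R) :
  (forall t : R, is_derive t 1 g (g' t)) -> continuous g' ->
  (forall t, M < `|t| -> g t = 0) -> (forall t, M < `|t| -> g' t = 0) ->
  (\int[@lebesgue_measure R]_t (g' t)%:E = 0)%E.
Proof.
(* [N] is positive and exceeds [M], so [[- N, N]] is nondegenerate and [g] vanishes at both of its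
   ends. *)
move=> dg cg' g0 g'0; pose N := `|M| + 1.
have MN : M < N by rewrite ltr_pwDr// ler_norm.
have N0 : 0 < N by rewrite ltr_wpDl.
have cg : continuous g.
  by move=> t; apply/differentiable_continuous/derivable1_diffP; case: (dg t).
have -> : (fun t => (g' t)%:E) = (EFin \o g') \_ `[- N, N].
  apply/funext => t; rewrite patchE; case: ifPn => // /negP; rewrite inE/= in_itv/= => tN.
  rewrite g'0//; apply: lt_le_trans MN _; rewrite leNgt ltr_norml; apply/negP => /andP[? ?].
  by apply: tN; rewrite !ltW.
rewrite -integral_mkcond (@continuous_FTC2 _ g' g).
- by rewrite !g0 ?subee// ?normrN (lt_le_trans MN)// ler_norm.
- by rewrite -subr_gt0 opprK addr_gt0.
- exact: continuous_subspaceT.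
- split; last 2 first.
  + exact/cvg_at_right_filter/cg.
  + exact/cvg_at_left_filter/cg.
  by move=> t _; case: (dg t).
- by move=> t _; rewrite derive1E; exact: derive_val.
Qed.

Lemma derive_support n (i : 'I_n) (g g' : 'rV[R]_n -> R) M x :
  is_derive x (delta_mx ord0 i) g (g' x) ->
  (forall x, M < `|x| -> g x = 0) -> M < `|x| -> g' x = 0.
Proof.
move=> dg g0 Mx; have [_ <-] := dg; apply: cvg_lim => //.
have M0 : 0 < (`|x| - M) by rewrite subr_gt0.
apply: (@cvg_trans _ ((fun=> 0 : R) @ 0^')); last exact: cvg_cst.
apply: near_eq_cvg.
near=> h => /=; rewrite !g0 ?subrr ?scaler0//.
have h1 : `|h *: (delta_mx ord0 i : 'rV[R]_n)| < `|x| - M.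
  rewrite mx_normZ.
  have -> : `|delta_mx ord0 i : 'rV[R]_n| = 1.
    apply/le_anti/andP; split.
      rewrite [leLHS]/Num.norm/= mx_normrE; apply: bigmax_le => // -[k j] _ /=;
        rewrite !mxE.
      by case: (_ && _); rewrite ?normr1 ?normr0.
    by have := coord_le_norm (delta_mx ord0 i : 'rV[R]_n) i; rewrite mxE !eqxx normr1.
  rewrite mulr1; near: h; exact: dnbhs0_lt.
have := ler_normB (h *: delta_mx ord0 i + x) (h *: delta_mx ord0 i).
by rewrite addrAC subrr add0r; lra.
Unshelve. all: by end_near. Qed.

(* Fubini reduces the integral to lines in the i-th direction, on which the
   fundamental theorem of calculus applies. *)
Lemma integral_partial_eq0 n (i : 'I_n) (g g' : 'rV[R]_n -> R) (M : R) :
  (forall x, is_derive x (delta_mx ord0 i) g (g' x)) -> continuous g' ->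
  (forall x, M < `|x| -> g x = 0) ->
  (\int[lebesgue_rV R n]_x (g' x)%:E = 0)%E.
Proof.
elim: n i g g' => [[]//|n IH] i g g' dg cg' g0.
have g'0 x : M < `|x| -> g' x = 0 by move=> Mx; exact: (derive_support (dg x) g0).
have mg' : measurable_fun setT (EFin \o g').
  by apply/measurable_EFinP; exact: continuous_measurable_rV.
have mgc : measurable_fun setT ((EFin \o g') \o @rV_cons R n).
  apply: measurableT_comp => //; exact: measurable_rV_cons.
(* Fubini needs integrability on the product: [g'] is continuous and vanishes off the cube [D], so
   it is bounded with support of finite measure. *)
have ig : (lebesgue_measure \x lebesgue_rV R n)%E.-integrable setT ((EFin \o g') \o
  @rV_cons R n).
  pose N := `|M| + 1.
  have MN : M < N by rewrite ltr_pwDr// ler_norm.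
  have cK : compact [set x : 'rV[R]_n.+1 | `|x| <= N].
    apply: bounded_closed_compact.
      by exists N; split; rewrite ?num_real// => y Ny x /= /le_trans; apply; exact: ltW.
    rewrite (_ : mkset _ = Num.norm @^-1` [set t | t <= N])//;
      apply: preimage_closed => [? _|]; [exact: norm_continuous|exact: closed_le].
  have /compact_bounded[C [_ /(_ (`|C| + 1))hC]] : compact (g' @` [set x | `|x| <= N]).
    by apply: continuous_compact => //; exact: continuous_subspaceT.
  have gC x : `|g' x| <= `|C| + 1.
    have [xN|xN] := leP `|x| N; last by rewrite g'0 ?normr0 ?addr_ge0// (lt_trans MN).
    by apply: hC; [rewrite ltr_pwDr// ler_norm|exists x].
  pose I := `[- N, N]%classic : set (measurableTypeR R).
  pose B := [set v : 'rV[R]_n | forall i, (const_mx (- N) : 'rV[R]_n) ord0 i <= v ord0 i <=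
    (const_mx N : 'rV[R]_n) ord0 i].
  have mI : measurable I by exact: measurable_itv.
  have mB : measurable B by exact: measurable_rV_box.
  pose D := I `*` B.
  have mD : measurable D by apply: measurableX.
  have -> : (EFin \o g') \o @rV_cons R n = ((EFin \o g') \o @rV_cons R n) \_ D.
    apply/funext => -[t v]; rewrite patchE; case: ifPn => // /negP; rewrite inE => nD /=.
    rewrite g'0//; apply: contrapT => /negP; rewrite -leNgt => le.
    have [h1 h2] := norm_rV_cons_ge t v.
    apply: nD; split => /=; first by rewrite /I/= in_itv/= -ler_norml; lra.
    by move=> j; rewrite !mxE -ler_norml (le_trans (coord_le_norm v j))//; lra.
  apply/(integrable_mkcond _ mD); apply: measurable_bounded_integrable => //.
  - have hD : (lebesgue_measure \x lebesgue_rV R n)%E D = (lebesgue_measure I * lebesgue_rV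
      R n B)%E.
      exact: product_measure1E.
    apply: (eq_ind_r (fun y => (y < +oo)%E) _ hD).
    rewrite lebesgue_rV_box => [|j];
      last by rewrite !mxE /N -subr_ge0 opprK addr_ge0// addr_ge0.
    rewrite [X in (X * _)%E](_ : _ = @lebesgue_measure R `[- N, N])//
      lebesgue_measure_itv/=.
    by case: ifP => _; rewrite -?EFinB -?EFinM ltry.
  - apply: measurable_funTS; apply: measurableT_comp; last exact: measurable_rV_cons.
    exact: continuous_measurable_rV.
  - exists (`|C| + 1); split; rewrite ?num_real// => y hy x _ /=.
    exact: le_trans (gC _) (ltW hy).
transitivity (\int[pushforward (lebesgue_measure \x lebesgue_rV R n)%E (@rV_cons R n)]_x
  (g' x)%:E)%E.
  by apply: eq_measure_integral; first exact: measurable_rV_cons.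
rewrite integral_pushforward//; last exact: measurable_rV_cons.
rewrite preimage_setT.
(* If [i] is not the first direction, integrating the tail first makes the induction hypothesis
   apply; otherwise the inner integral is over the first coordinate. *)
case: (unliftP ord0 i) dg => [j|] -> dg.
  rewrite -integral12_prod_meas1//; apply: integral0_eq => t _.
  apply: (IH j (fun v => g (rV_cons (t, v)))) => [v||v Mv].
  - have := dg (rV_cons (t, v));
      rewrite -[X in is_derive X](addr0 _) -[X in _ + X](scale0r (delta_mx ord0 (lift ord0
        j))).
    move=> /is_derive_line.
    under [X in is_derive _ _ X _]eq_fun do rewrite rV_cons_shift.
    by move=> /(is_derive_line (fun v => g (rV_cons (t, v)))); rewrite scale0r addr0.
  - exact: continuous_rV_cons2.
  - by apply: g0; apply: lt_le_trans Mv _; have [] := norm_rV_cons_ge t v.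
rewrite -integral21_prod_meas1//; apply: integral0_eq => v _.
apply: (@integral_line_eq0 (fun t => g (rV_cons (t, v))) _ M) => [t||t Mt|t Mt].
- have := dg (rV_cons (0, v) + t *: delta_mx ord0 ord0); move=> /is_derive_line.
  rewrite rV_cons_shift0 add0r.
  by under [X in is_derive _ _ X _]eq_fun do rewrite rV_cons_shift0 add0r.
- exact: continuous_rV_cons1.
- by apply: g0; apply: lt_le_trans Mt _; have [] := norm_rV_cons_ge t v.
- by apply: g'0; apply: lt_le_trans Mt _; have [] := norm_rV_cons_ge t v.
Qed.

End integral_partial.

(** * Smooth bumps *)

Section smooth1.
Context {R : realType}.
Implicit Types (f g h : R -> R) (p : {poly R}).

Lemma is_derive_ext f g (t df dg : R) :
  is_derive t 1 f df -> f =1 g -> df = dg -> is_derive t 1 g dg.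
Proof. by move=> + /funext <- <-. Qed.

(* Coinductive, so that a family closed under differentiation is handled by
   guarded corecursion, without formulas for the higher derivatives. *)
CoInductive infinitely_derivable f : Prop := InfinitelyDerivable g of
  (forall t : R, is_derive t 1 f (g t)) & infinitely_derivable g.

(** The polynomial makes the family stable under differentiation: every derivative of exp(-1/t) is
    exp(-1/t) times a polynomial in 1/t. *)
Definition flat_exp p (t : R) : R :=
  if 0 < t then p.[t^-1] * expR (- t^-1) else 0.

(** Coefficientwise, [s ^+ i * expR (- s) <= i%:R ^+ i]: raise [s / i <= expR (s / i)] to the power
    [i]. For [i = 0] this relies on [0 ^+ 0 = 1]. *)
Lemma horner_expR_bounded p : exists C : R, forall s, 0 < s ->
  `|p.[s] * expR (- s)| <= C.
Proof.
exists (\sum_(i < size p) `|p`_i| * (i%:R ^+ i)) => s s0.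
rewrite horner_coef mulr_suml; apply: le_trans (ler_norm_sum _ _ _) _.
apply: ler_sum => i _; rewrite -mulrA normrM ler_wpM2l//.
rewrite ger0_norm ?mulr_ge0 ?exprn_ge0 ?expR_ge0 ?(ltW s0)//.
rewrite expRN -ler_pdivlMr ?invr_gt0 ?expR_gt0// invrK.
case: (nat_of_ord i) => [|k]; first by rewrite !expr0 mul1r ltW// expR_gt1.
have k0 : (0 : R) < k.+1%:R by rewrite ltr0n.
have -> : expR s = expR (s / k.+1%:R) ^+ k.+1 by rewrite -expRM_natl mulrC divfK ?gt_eqF.
rewrite -exprMn ler_pXn2r ?nnegrE ?mulr_ge0 ?expR_ge0 ?(ltW s0) ?(ltW k0)//.
rewrite -ler_pdivrMl// mulrC; apply: le_trans (expR_ge1Dx _).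
by rewrite lerDr.
Qed.

(** The polynomial bound is used for ['X * p]: the extra factor 1/t is what gains [|t|]. *)
Lemma flat_exp_small p : exists C : R, forall t, `|flat_exp p t| <= C * `|t|.
Proof.
have [C hC] := horner_expR_bounded ('X * p).
have C0 : 0 <= C by apply: le_trans (hC 1 ltr01).
exists C => t; rewrite /flat_exp; case: ifPn => t0; last by rewrite normr0 mulr_ge0.
have := hC t^-1; rewrite invr_gt0 t0 => /(_ isT).
rewrite hornerM hornerX -mulrA normrM normfV => h.
by rewrite -ler_pdivrMr ?normr_gt0 ?gt_eqF// mulrC.
Qed.

Lemma is_derive_flat_exp p (t : R) :
  is_derive t 1 (flat_exp p) (flat_exp ('X ^+ 2 * (p - p^`())) t).
Proof.
have [t0|t0|->] := ltgtP t 0.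
- have -> : flat_exp ('X ^+ 2 * (p - p^`())) t = 0 by rewrite /flat_exp ltNge (ltW t0).
  apply: (near_eq_is_derive (f := cst 0)).
  near=> s; rewrite /flat_exp ltNge.
  suff -> : s <= 0 by [].
  by apply/ltW; near: s; exact: lt_nbhsl.
- have dV : is_derive t 1 (fun s : R => s^-1) (- t ^- 2).
    by apply: (is_derive_ext (@is_deriveV R id t 1 1 _ _)); rewrite ?gt_eqF//= [LHS]mulr1.
  have dp := @is_derive1_comp R (horner p) (fun s => s^-1) t _ _ (is_derive_poly p _) dV.
  have dN : is_derive t 1 (fun s : R => - s^-1) (t ^- 2).
    by apply: (is_derive_ext (is_deriveN dV)) => //; rewrite opprK.
  have de := @is_derive1_comp R expR (fun s => - s^-1) t _ _ (is_derive_expR _) dN.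
  have dpe := is_deriveM dp de.
  apply: (is_derive_eq (near_eq_is_derive _ dpe)).
    near=> s; rewrite /flat_exp.
    suff -> : 0 < s by [].
    by near: s; exact: lt_nbhsr.
  rewrite /flat_exp t0 !hornerE /= /GRing.scale /=.
  rewrite exprVn; ring.
- have -> : flat_exp ('X ^+ 2 * (p - p^`())) 0 = 0 by rewrite /flat_exp ltxx.
  have [C hC] := flat_exp_small ('X * p).
  (* The difference quotient of [flat_exp p] at 0 is [flat_exp ('X * p)], which tends to 0 by the
     linear bound. *)
  have lim0 : (fun h : R => h^-1 *: ((flat_exp p \o shift 0) (h *: 1) - flat_exp p 0)) @
    0^' --> (0 : R).
    have -> : (fun h : R => h^-1 *: ((flat_exp p \o shift 0) (h *: 1) - flat_exp p 0)) =
      flat_exp ('X * p).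
      apply/funext => h /=; rewrite [h *: 1]mulr1 addr0 /flat_exp ltxx subr0.
      case: ifPn => _; last by rewrite scaler0.
      by rewrite hornerM hornerX -mulrA.
    apply/cvgrPdist_lt => e e0; near=> h; rewrite sub0r normrN.
    have C1 : 0 < `|C| + 1 by rewrite ltr_wpDl.
    apply: (@le_lt_trans _ _ ((`|C| + 1) * `|h|)).
      apply: le_trans (hC h) _; rewrite ler_wpM2r//.
      by apply: le_trans (ler_norm _) _; rewrite lerDl.
    rewrite mulrC -ltr_pdivlMr//; near: h; apply: dnbhs0_lt; exact: divr_gt0.
  by constructor; [apply/cvg_ex; exists 0|exact: cvg_lim].
Unshelve. all: by end_near. Qed.

Lemma infinitely_derivable_flat_exp p : infinitely_derivable (flat_exp p).
Proof.
move: p; cofix CIH => p.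
exists (flat_exp ('X ^+ 2 * (p - p^`()))); last exact: CIH.
exact: is_derive_flat_exp.
Qed.

Lemma infinitely_derivable_affine f (c k a : R) : infinitely_derivable f ->
  infinitely_derivable (fun t => c * f (k * t + a)).
Proof.
move: f c; cofix CIH => f c [g fg ig].
exists (fun t => (c * k) * g (k * t + a)); last exact: CIH.
move=> t.
have dl : is_derive t 1 (fun t : R => k * t + a) k.
  apply: (is_derive_ext (is_deriveD (is_deriveZ k (is_derive_id t 1)) (is_derive_cst a t
    1))) => //.
  by rewrite addr0 [LHS]mulr1.
have := is_deriveZ c (@is_derive1_comp R f (fun t => k * t + a) t _ _ (fg _) dl).
by move/is_derive_ext; apply => //=; rewrite /GRing.scale /=; ring.
Qed.

Inductive sum_of_products : (R -> R) -> Prop :=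
| SOPmul f g : infinitely_derivable f -> infinitely_derivable g ->
    sum_of_products (fun t => f t * g t)
| SOPadd f g : sum_of_products f -> sum_of_products g ->
    sum_of_products (fun t => f t + g t).

(* Products alone are not closed under differentiation, finite sums of them are. *)
Lemma infinitely_derivableM f g : infinitely_derivable f ->
  infinitely_derivable g -> infinitely_derivable (fun t => f t * g t).
Proof.
have step h : sum_of_products h -> exists2 h' : R -> R,
    forall t : R, is_derive t 1 h (h' t) & sum_of_products h'.
  elim=> {h} [f1 g1 [f' df if'] [g' dg ig']|f1 g1 _ [f' df if'] _ [g' dg ig']].
    exists (fun t => f' t * g1 t + f1 t * g' t).
      move=> t; apply: (is_derive_ext (is_deriveM (df t) (dg t))) => //.
      by rewrite /GRing.scale /= addrC mulrC.
    apply: SOPadd; apply: SOPmul => //; [by exists g'|by exists f'].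
  exists (fun t => f' t + g' t); last exact: SOPadd.
  by move=> t; exact: (is_deriveD (df t) (dg t)).
have key : forall h, sum_of_products h -> infinitely_derivable h.
  cofix CIH => h /step[h' dh sh].
  by exists h' => //; exact: CIH.
by move=> cf cg; apply: key; exact: SOPmul.
Qed.

Definition bump (d t : R) := flat_exp 1 (t + d) * flat_exp 1 (d - t).

Lemma flat_exp1_ge0 t : 0 <= flat_exp 1 t.
Proof. by rewrite /flat_exp; case: ifPn => // t0; rewrite hornerC mul1r expR_ge0. Qed.

Lemma flat_exp1_gt0 t : 0 < t -> 0 < flat_exp 1 t.
Proof. by move=> t0; rewrite /flat_exp t0 hornerC mul1r expR_gt0. Qed.

Lemma bump_ge0 d t : 0 <= bump d t.
Proof. by rewrite mulr_ge0// flat_exp1_ge0. Qed.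

Lemma bump_gt0 d t : `|t| < d -> 0 < bump d t.
Proof.
rewrite ltr_norml => /andP[h1 h2]; rewrite mulr_gt0// flat_exp1_gt0 ?subr_gt0//.
by rewrite -ltrBlDr sub0r.
Qed.

Lemma bump_eq0 d t : d <= `|t| -> bump d t = 0.
Proof.
rewrite ler_normr => /orP[dt|dt]; rewrite /bump /flat_exp.
  by rewrite [in X in _ * X]ifF ?mulr0// subr_gt0 ltNge dt.
by rewrite ifF ?mul0r// ltNge -lerBrDr sub0r lerNr dt.
Qed.

Lemma infinitely_derivable_bump d : infinitely_derivable (bump d).
Proof.
apply: infinitely_derivableM.
  have := infinitely_derivable_affine 1 1 d (infinitely_derivable_flat_exp 1).
  by under eq_fun do rewrite !mul1r.
have := infinitely_derivable_affine 1 (-1) d (infinitely_derivable_flat_exp 1).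
by under eq_fun do rewrite mul1r mulN1r addrC.
Qed.

End smooth1.

(** * Products of one-variable functions as test functions *)

Section tensor.
Context {R : realType} {n : nat}.
Implicit Types (f : 'I_n -> R -> R) (x y v a : 'rV[R]_n).

Definition tensor f y : R := \prod_(i < n) f i (y ord0 i).

(** A partial derivative of a product of one-variable functions changes a single factor, so it is
    again such a product. *)
Definition replace f f' (i : 'I_n) : 'I_n -> R -> R :=
  fun j => if j == i then f' j else f j.

Lemma is_derive_tensor f f' y v :
  (forall i (t : R), is_derive t 1 (f i) (f' i t)) ->
  is_derive y v (tensor f) (\sum_i v ord0 i * tensor (replace f f' i) y).
Proof.
move=> df.
have dc i : is_derive y v (fun z => f i (z ord0 i)) (v ord0 i * f' i (y ord0 i)).
  have := (is_derive_line (fun z => f i (z ord0 i)) y v 0 (v ord0 i * f' i (y ord0 i))).2.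
  rewrite scale0r addr0; apply.
  have da : is_derive (0 : R) 1 (fun s => y ord0 i + s * v ord0 i) (v ord0 i).
    apply: (is_derive_ext (is_deriveD (is_derive_cst (y ord0 i) (0 : R) 1)
      (is_deriveZ (v ord0 i) (is_derive_id (0 : R) 1)))) => [s /=|].
      by rewrite !fctE /= [X in _ + X]mulrC.
    by rewrite add0r [LHS]mulr1.
  have dfi : is_derive ((fun s => y ord0 i + s * v ord0 i) 0) 1 (f i) (f' i (y ord0 i)).
    by rewrite /= mul0r addr0.
  apply: (is_derive_ext (@is_derive1_comp R (f i) (fun s => y ord0 i + s * v ord0 i) 0 _ _
    dfi da)) => [s|]; last by rewrite mulrC.
  by rewrite /= !mxE.
(* The induction on the Leibniz rule runs over duplicate-free lists, since [replace] would alter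
   every occurrence of an index. *)
have key (s : seq 'I_n) : uniq s ->
    is_derive y v (fun z => \prod_(i <- s) f i (z ord0 i))
      (\sum_(i <- s) v ord0 i * \prod_(j <- s) replace f f' i j (y ord0 j)).
  elim: s => [_|i s IH /= /andP[si us]].
    rewrite big_nil; under eq_fun do rewrite big_nil.
    exact: is_derive_cst.
  under eq_fun do rewrite big_cons.
  apply: (is_derive_eq (is_deriveM (dc i) (IH us))).
  rewrite big_cons /GRing.scale /= addrC; congr (_ + _).
    rewrite big_cons /replace eqxx mulrC -mulrA; congr (_ * (_ * _)).
    rewrite big_seq [RHS]big_seq; apply: eq_bigr => j js.
    by rewrite ifN//; apply: contraNneq si => <-.
  rewrite mulr_sumr big_seq [RHS]big_seq; apply: eq_bigr => k ks.
  rewrite big_cons mulrCA; congr (_ * (_ * _)); rewrite /replace ifN//.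
  by apply: contraNneq si => ->.
exact: (key _ (index_enum_uniq _)).
Qed.

Lemma tensor_delta f f' y (i : 'I_n) :
  \sum_j (delta_mx ord0 i : 'rV[R]_n) ord0 j * tensor (replace f f' j) y =
  tensor (replace f f' i) y.
Proof.
rewrite (bigD1 i)//= big1 ?addr0 => [|j ji]; first by rewrite mxE !eqxx mul1r.
by rewrite mxE eqxx (negbTE ji) mul0r.
Qed.

Lemma continuous_tensor f : (forall i, continuous (f i)) -> continuous (tensor f).
Proof.
move=> cf y.
have key (s : seq 'I_n) :
    continuous (fun z : 'rV[R]_n => \prod_(i <- s) f i (z ord0 i)).
  elim: s => [|i s IH].
    rewrite (_ : (fun _ => _) = cst 1); first exact: cst_continuous.
    by apply/funext => z; rewrite big_nil.
  rewrite (_ : (fun _ => _) = (fun z : 'rV[R]_n => f i (z ord0 i) * \prod_(i <- s) f i (z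
    ord0 i))).
    have ci : continuous (f i \o (fun z : 'rV[R]_n => z ord0 i)).
      by move=> z; apply: continuous_comp; [exact: coord_continuous|exact: cf].
    move=> z; apply: (@cvgM _ _ (nbhs z) _ (f i \o (fun z : 'rV[R]_n => z ord0 i)) _ _ _
      (ci z) (IH z)).
  by apply/funext => z; rewrite big_cons.
exact: key.
Qed.

Lemma iter_partial_tensor (s : seq 'I_n) f :
  (forall i, infinitely_derivable (f i)) ->
  exists2 g, (forall i, infinitely_derivable (g i)) &
    iter_partial s (tensor f) = tensor g.
Proof.
move=> cf; elim: s => [|i s [g cg E]]; first by exists f.
have /choice[g' dg] : forall j, exists g', (forall t : R, is_derive t 1 (g j) (g' t)) /\
  infinitely_derivable g'.
  by move=> j; case: (cg j) => g' d1 d2; exists g'.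
exists (replace g g' i) => [j|].
  by rewrite /replace; case: ifP => _; [case: (dg j)|].
rewrite /= E /partial; apply/funext => y.
have := is_derive_tensor y (delta_mx ord0 i) (fun j => (dg j).1).
by rewrite tensor_delta => -[_ ->].
Qed.

Lemma continuous_infinitely_derivable (f : R -> R) :
  infinitely_derivable f -> continuous f.
Proof.
case=> g df _ t; apply/differentiable_continuous/derivable1_diffP.
by case: (df t).
Qed.

Lemma smooth_tensor f : (forall i, infinitely_derivable (f i)) ->
  smooth (tensor f).
Proof.
move=> cf s; have [g cg ->] := iter_partial_tensor s cf; split.
  by apply: continuous_tensor => i; exact: continuous_infinitely_derivable.
have /choice[g' dg] : forall j, exists g', forall t : R, is_derive t 1 (g j) (g' t).
  by move=> j; case: (cg j) => g' d1 d2; exists g'.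
by move=> i x; case: (is_derive_tensor x (delta_mx ord0 i) dg).
Qed.

Lemma partial_tensor f f' (i : 'I_n) :
  (forall i (t : R), is_derive t 1 (f i) (f' i t)) ->
  partial i (tensor f) = tensor (replace f f' i).
Proof.
move=> df; apply/funext => y.
by have := is_derive_tensor y (delta_mx ord0 i) df; rewrite tensor_delta => -[_ <-].
Qed.

(** A point at maximum-norm distance at least [d] from [a] has one coordinate that far, and this
    kills a factor. The condition [0 < d] excludes dimension 0, where the empty product is 1. *)
Lemma tensor_eq0 f (d : R) y a :
  (forall i t, d <= `|t - a ord0 i| -> f i t = 0) -> d <= `|y - a| -> 0 < d ->
  tensor f y = 0.
Proof.
move=> f0 dy d0.
have /existsP[i di] : [exists i, d <= `|y ord0 i - a ord0 i|].
  apply: contraLR dy => /existsPn h; rewrite -ltNge [ltLHS]/Num.norm/= mx_normrE.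
  apply: bigmax_lt => // -[j i] _ /=; rewrite !mxE ord1 ltNge; exact: h.
by rewrite /tensor (bigD1 i)//= f0// mul0r.
Qed.

Lemma test_function_tensor f (d : R) a (Omega : set 'rV[R]_n) :
  (forall i, infinitely_derivable (f i)) -> 0 < d ->
  (forall i t, d <= `|t - a ord0 i| -> f i t = 0) ->
  (forall y, `|y - a| <= d -> Omega y) ->
  test_function Omega (tensor f).
Proof.
move=> cf d0 f0 hO.
have cK : closed [set y | `|y - a| <= d].
  rewrite (_ : mkset _ = (fun y => `|y - a|) @^-1` [set t | t <= d])//.
  apply: preimage_closed => [y _|]; last exact: closed_le.
  apply: (@lipschitz_continuous _ _ _ 1) => x z; rewrite mul1r.
  apply: le_trans (ler_dist_dist _ _) _.
  by rewrite opprB addrA subrK norm_le_enorm.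
have sK : closure [set y | tensor f y != 0] `<=` [set y | `|y - a| <= d].
  rewrite [X in _ `<=` X](closure_id _).1//; apply: closureS => y /=.
  by apply: contraNT; rewrite -ltNge => /ltW dy; rewrite (tensor_eq0 f0).
split; first exact: smooth_tensor.
  apply: bounded_closed_compact; last exact: closed_closure.
  exists (d + `|a|); split; rewrite ?num_real// => M dM y /sK /= ya.
  have := ler_normD (y - a) a; rewrite subrK; lra.
by move=> y /sK /hO.
Qed.

End tensor.

(** * Essentially bounded functions *)

Section Linfty_theory.
Context {R : realType} {n : nat}.
Local Notation mu := (lebesgue_rV R n).
Variable Omega : set 'rV[R]_n.
Implicit Types (w : 'rV[R]_n -> R).

(** The norm is that of the extension of [w] by 0 to the whole space, so [c] has to dominate 0 as
    well. *)
Lemma Linfty_norm_leP w (c : R) : 0 <= c ->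
  (Linfty_norm Omega w <= c%:E)%E <->
  {ae mu, forall x, Omega x -> `|w x| <= c}.
Proof.
(* The norm of exponent [+oo] is an essential supremum only on a space of positive measure. *)
move=> c0; rewrite /Linfty_norm unlock ifT; last first.
  by apply: lebesgue_rV_open_gt0; [exact: openT|exists 0].
split => [/ess_supP|h]; last apply/ess_supP; [|move: h]; apply: filterS => x /=;
  rewrite patchE.
  by move=> + Ox; rewrite mem_set.
by case: ifPn => [|_ _]; [rewrite inE lee_fin => Ox; exact|rewrite normr0 lee_fin].
Qed.

Lemma Linfty_norm_ge0 w : (0 <= Linfty_norm Omega w)%E.
Proof. exact: Lnorm_ge0. Qed.

Hypothesis Omega_open : open Omega.
Hypothesis Omega_bounded : bounded_set Omega.

Let mOmega : measurable Omega. Proof. exact: open_measurable_rV. Qed.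

Let muOmega : (mu Omega < +oo)%E. Proof. exact: lebesgue_rV_bounded_lty. Qed.

Lemma ae_bounded_integrable w (c : R) : measurable_fun Omega w ->
  {ae mu, forall x, Omega x -> `|w x| <= c} ->
  mu.-integrable Omega (EFin \o w).
Proof.
move=> mw wc; apply/integrableP; split; first exact/measurable_EFinP.
apply: (@le_lt_trans _ _ (\int[mu]_(x in Omega) (cst `|c|%:E) x)%E).
  apply: ae_ge0_le_integral => //.
  - by apply: measurableT_comp => //; exact/measurable_EFinP.
  - by move=> x _; rewrite lee_fin.
  - by apply: filterS wc => x wc Ox /=; rewrite lee_fin (le_trans (wc Ox))// ler_norm.
by rewrite integral_cst// lte_mul_pinfty.
Qed.

Lemma Linfty_integrable w : Linfty Omega w -> mu.-integrable Omega (EFin \o w).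
Proof.
move=> [mw wy].
have wfin : Linfty_norm Omega w \is a fin_num by rewrite ge0_fin_numE// Linfty_norm_ge0.
apply: (@ae_bounded_integrable _ (fine (Linfty_norm Omega w))) => //.
by apply/Linfty_norm_leP; rewrite ?fineK// fine_ge0// Linfty_norm_ge0.
Qed.

Lemma continuous_bounded_on w : continuous w -> [bounded w x | x in Omega].
Proof.
move=> cw.
have /compact_bounded : compact (w @` closure Omega).
  apply: continuous_compact; first exact: continuous_subspaceT.
  exact: compact_closure.
move=> [M [Mr h]]; exists M; split => // N MN x Ox.
by apply: h MN _ _; exists x => //; exact: subset_closure.
Qed.

Lemma continuous_integrable w : continuous w -> mu.-integrable Omega (EFin \o w).
Proof.
move=> cw; apply: measurable_bounded_integrable => //.
  by apply: measurable_funTS; exact: continuous_measurable_rV.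
exact: continuous_bounded_on.
Qed.

Lemma continuous_Linfty w : continuous w -> Linfty Omega w.
Proof.
move=> cw; split; first by apply: measurable_funTS; exact: continuous_measurable_rV.
have [M [_ /(_ (`|M| + 1)) h]] := continuous_bounded_on cw.
apply: (@le_lt_trans _ _ (`|M| + 1)%:E); last exact: ltry.
apply/Linfty_norm_leP; first by rewrite addr_ge0.
by apply: aeW => x Ox; apply: h => //; rewrite ltr_pwDr// ler_norm.
Qed.

(** Integration by parts: the i-th partial derivative of [w * phi] has integral 0 over the whole
    space, and the integrals over [Omega] are the same because [phi] and its derivative vanish
    outside. *)
Lemma smooth_weak_gradient w (G : 'rV[R]_n -> 'rV[R]_n) :
  continuous w -> (forall i, continuous (fun x => G x ord0 i)) ->
  (forall i x, is_derive x (delta_mx ord0 i) w (G x ord0 i)) ->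
  is_weak_gradient Omega w G.
Proof.
move=> cw cG dw i phi [sphi cphi supp].
have dphi x : is_derive x (delta_mx ord0 i) phi (partial i phi x).
  by apply: derivableP; exact: (sphi [::]).2.
have cphi0 : continuous phi := (sphi [::]).1.
have cphi1 : continuous (partial i phi) := (sphi [:: i]).1.
have phi0 x : ~ Omega x -> phi x = 0.
  move=> nOx; apply: contra_notP nOx => /eqP h.
  by apply: supp; exact: subset_closure.
have [M [_ hM]] := Omega_bounded.
have phiM x : `|M| + 1 < `|x| -> phi x = 0.
  move=> Mx; apply: phi0 => Ox.
  have MM : M < `|M| + 1 by rewrite ltr_pwDr// ler_norm.
  by have /= := hM _ MM x Ox; rewrite leNgt Mx.
have dphi0 x : ~ Omega x -> partial i phi x = 0.
  move=> nOx; apply: derive_val;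
    apply: near_eq_is_derive (is_derive_cst (0 : R) x (delta_mx ord0 i)).
  have : open (~` closure [set x | phi x != 0]) by apply: closed_openC;
    exact: closed_closure.
  have nx : (~` closure [set x | phi x != 0]) x by move=> /supp.
  move=> o; apply: filterS (open_nbhs_nbhs (conj o nx)) => y ny.
  apply: contrapT => h; apply: ny; apply: subset_closure => /=.
  by apply/eqP => E; apply: h; rewrite E.
have iwphi : mu.-integrable Omega (EFin \o (fun x => w x * partial i phi x)).
  by apply: continuous_integrable => x; apply: continuousM; [exact: cw|exact: cphi1].
have iGphi : mu.-integrable Omega (EFin \o (fun x => G x ord0 i * phi x)).
  by apply: continuous_integrable => x; apply: continuousM; [exact: cG|exact: cphi0].
apply/eqP; rewrite -addr_eq0 -RintegralD//; apply/eqP.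
rewrite Rintegral_mkcond /Rintegral.
pose g x := w x *: partial i phi x + phi x *: G x ord0 i.
rewrite (_ : (fun x => _%:E) = (fun x => (g x)%:E)); last first.
  apply/funext => x; rewrite patchE /g /GRing.scale /=; case: ifPn => [_|];
    first by rewrite [phi x * _]mulrC.
  by rewrite notin_setE => nOx; rewrite phi0// dphi0// mulr0 mul0r addr0.
rewrite (@integral_partial_eq0 R n i (w * phi) g (`|M| + 1))//.
- move=> x; apply: (@continuousD _ _ _ (w \* partial i phi) (phi \* fun y => G y ord0 i)).
    by apply: continuousM; [exact: cw|exact: cphi1].
  by apply: continuousM; [exact: cphi0|exact: cG].
- by move=> x Mx; rewrite [LHS]/GRing.mul /= phiM ?mulr0.
Qed.

End Linfty_theory.

(** * Lipschitz estimate from the weak gradient *)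

Section weighted_average.
Context {R : realType} {n : nat}.
Local Notation mu := (lebesgue_rV R n).
Variable Omega : set 'rV[R]_n.
Hypothesis Omega_open : open Omega.
Hypothesis Omega_bounded : bounded_set Omega.
Implicit Types (v phi : 'rV[R]_n -> R).

Let mOmega : measurable Omega. Proof. exact: open_measurable_rV. Qed.

Lemma integrableM_continuous v phi :
  mu.-integrable Omega (EFin \o v) -> continuous phi ->
  mu.-integrable Omega (EFin \o (fun x => v x * phi x)).
Proof.
move=> iv cphi.
apply: (@integrableMl _ _ _ mu Omega mOmega (EFin \o v) phi iv).
  by apply: measurable_funTS; exact: continuous_measurable_rV.
exact: continuous_bounded_on.
Qed.

(** Stated multiplied by the mass of [phi], so that the weight need not be normalized. It serves
    twice: near an endpoint, with [k] the value of [u] there, and with [k = 0] to bound the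
    derivative of a moving average. *)
Lemma weighted_average_dist v phi (k e : R) :
  mu.-integrable Omega (EFin \o v) -> continuous phi ->
  (forall x, 0 <= phi x) -> 0 <= e ->
  {ae mu, forall x, Omega x -> phi x != 0 -> `|v x - k| <= e} ->
  `|\int[mu]_(x in Omega) (v x * phi x) - k * \int[mu]_(x in Omega) phi x|
  <= e * \int[mu]_(x in Omega) phi x.
Proof.
move=> iv cphi phi0 e0 ae_.
have iphi := continuous_integrable Omega_open Omega_bounded cphi.
have ivphi := integrableM_continuous iv cphi.
have iZ c : mu.-integrable Omega (EFin \o (fun x => c * phi x)).
  exact: (@integrableZl _ _ _ mu Omega mOmega c _ iphi).
rewrite -!RintegralZl// -RintegralB//.
have id : mu.-integrable Omega (EFin \o (fun x => v x * phi x - k * phi x)).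
  exact: (@integrableB _ _ _ mu Omega mOmega _ _ ivphi (iZ k)).
apply: le_trans (le_normr_Rintegral mOmega id) _.
rewrite /Rintegral fine_le//.
- exact: (@integrable_fin_num _ _ _ mu Omega mOmega _ (integrable_abse id)).
- exact: (@integrable_fin_num _ _ _ mu Omega mOmega _ (iZ e)).
apply: ae_ge0_le_integral => //.
- exact/measurable_int/(integrable_abse id).
- by move=> x _; rewrite lee_fin mulr_ge0.
- exact/measurable_int/(iZ e).
apply: filterS ae_ => x h Ox; rewrite lee_fin -mulrBl normrM (ger0_norm (phi0 x)).
have [->|p0] := eqVneq (phi x) 0; first by rewrite !mulr0.
by rewrite ler_wpM2r// h.
Qed.

End weighted_average.

(** * Averages of [w] against a moving bump *)

Section weak_gradient_line.
Context {R : realType} {n : nat}.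
Local Notation mu := (lebesgue_rV R n).
Variable Omega : set 'rV[R]_n.
Hypothesis Omega_open : open Omega.
Hypothesis Omega_bounded : bounded_set Omega.
Implicit Types (w : 'rV[R]_n -> R) (G : 'rV[R]_n -> 'rV[R]_n) (a h : 'rV[R]_n).

Let mOmega : measurable Omega. Proof. exact: open_measurable_rV. Qed.

Definition translated_bump (d : R) a : 'rV[R]_n -> R :=
  tensor (fun i t => bump d (t - a ord0 i)).

Lemma infinitely_derivable_translated_bump d (c : R) :
  infinitely_derivable (fun t => bump d (t - c)).
Proof.
have := infinitely_derivable_affine 1 1 (- c) (infinitely_derivable_bump d).
by under eq_fun do rewrite !mul1r.
Qed.

Lemma continuous_translated_bump d a : continuous (translated_bump d a).
Proof.
apply: continuous_tensor => i.
exact/continuous_infinitely_derivable/infinitely_derivable_translated_bump.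
Qed.

Lemma translated_bump_ge0 d a y : 0 <= translated_bump d a y.
Proof. by apply: prodr_ge0 => i _; exact: bump_ge0. Qed.

Lemma translated_bump_neq0 d a y : 0 < d -> translated_bump d a y != 0 -> `|y - a| < d.
Proof.
move=> d0; apply: contraNlt => dy; apply/eqP/(tensor_eq0 _ dy d0) => i t.
exact: bump_eq0.
Qed.

(** A zero integral would make the bump vanish almost everywhere, although it is nonzero on a
    nonempty open set, which has positive measure. *)
Lemma Rintegral_translated_bump_gt0 d a : 0 < d ->
  (forall y, `|y - a| <= d -> Omega y) ->
  0 < \int[mu]_(x in Omega) translated_bump d a x.
Proof.
move=> d0 dO.
have cb := @continuous_translated_bump d a.
have ib := continuous_integrable Omega_open Omega_bounded cb.
rewrite lt_def Rintegral_ge0 ?andbT => [|y _]; last exact: translated_bump_ge0.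
apply/eqP => I0.
have : (\int[mu]_(x in Omega) `|(translated_bump d a x)%:E| = 0)%E.
  under eq_integral do rewrite gee0_abs ?lee_fin ?translated_bump_ge0//.
  rewrite -[LHS]fineK; last exact: (@integrable_fin_num _ _ _ mu Omega mOmega _ ib).
  by congr EFin.
move/(ae_eq_integral_abs mu mOmega (measurable_int _ ib)) => [N [mN N0 sub]].
have oU : open [set y | translated_bump d a y != 0].
  rewrite (_ : mkset _ = translated_bump d a @^-1` [set t | t != 0])//.
  by apply: open_comp => [y _|]; [exact: cb|exact: open_neq].
have : (0 < mu [set y | translated_bump d a y != 0%R])%E.
  apply: lebesgue_rV_open_gt0 => //; exists a => /=.
  rewrite gt_eqF// prodr_gt0// => i _; apply: bump_gt0.
  by rewrite subrr normr0.
apply/negP; rewrite -leNgt -N0; apply: le_measure; rewrite ?inE//.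
  exact: open_measurable_rV.
move=> y /= yn; apply: sub => /= h.
have /ltW/dO Oy := translated_bump_neq0 d0 yn.
by have [] := h Oy; apply/eqP.
Qed.

Lemma derive_bump_eq0 (d : R) (db : R -> R) (t : R) :
  (forall t : R, is_derive t 1 (bump d) (db t)) -> d < `|t| -> db t = 0.
Proof.
move=> ddb dt; have [_ <-] := ddb t.
apply: derive_val; apply: near_eq_is_derive (is_derive_cst (0 : R) t (1 : R)).
have : open (Num.norm @^-1` [set s : R | d < s] : set R).
  by apply: open_comp => [s _|]; [exact: norm_continuous|exact: open_gt].
move=> o; apply: filterS (open_nbhs_nbhs (conj o dt)) => s /= ds.
by rewrite bump_eq0// ltW.
Qed.

Lemma tensor_bounded (f : 'I_n -> R -> R) (d : R) :
  (forall i, continuous (f i)) -> 0 < d ->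
  (forall i t, d <= `|t| -> f i t = 0) ->
  exists2 C : R, 0 <= C & forall y, `|tensor f y| <= C.
Proof.
move=> cf d0 f0.
have cK : compact [set y : 'rV[R]_n | `|y| <= d].
  apply: bounded_closed_compact.
    by exists d; split; rewrite ?num_real// => N dN y /= /le_trans; apply; exact: ltW.
  rewrite (_ : mkset _ = Num.norm @^-1` [set t | t <= d])//.
  by apply: preimage_closed => [? _|]; [exact: norm_continuous|exact: closed_le].
have /compact_bounded[M [_ /(_ (`|M| + 1)) h]] : compact (tensor f @` [set y | `|y| <= d]).
  by apply: continuous_compact => //; apply: continuous_subspaceT; exact: continuous_tensor.
exists (`|M| + 1); first by rewrite addr_ge0.
move=> y; have [yd|/ltW dy] := leP `|y| d.
  by apply: h; [rewrite ltr_pwDr// ler_norm|exists y].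
rewrite (@tensor_eq0 _ _ f d y 0) ?normr0 ?addr_ge0 ?subr0//.
by move=> i t; rewrite mxE subr0; exact: f0.
Qed.

Lemma Rintegral_sum (I : Type) (s : seq I) (f : I -> 'rV[R]_n -> R) :
  (forall i, mu.-integrable Omega (EFin \o f i)) ->
  mu.-integrable Omega (EFin \o (fun x => \sum_(i <- s) f i x)) /\
  \int[mu]_(x in Omega) (\sum_(i <- s) f i x) =
  \sum_(i <- s) \int[mu]_(x in Omega) f i x.
Proof.
move=> fi; elim: s => [|i s [Is E]].
  rewrite big_nil (_ : (fun x => _) = cst 0); last by apply/funext => x; rewrite big_nil.
  split; first by exact: integrable0.
  by rewrite /Rintegral integral0.
have -> : (fun x => \sum_(j <- i :: s) f j x) = (fun x => f i x + \sum_(j <- s) f j x).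
  by apply/funext => x; rewrite big_cons.
split; first exact: (@integrableD _ _ _ mu Omega mOmega _ _ (fi i) Is).
by rewrite RintegralD// big_cons E.
Qed.

(** Differentiation under the integral sign falls on the bump and gives minus its derivative along
    [h]; the sign in the definition of the weak gradient then cancels. Only the bump at time [s] has
    to be a test function, since the dominating function is valid at all times. *)
Lemma is_derive_bump_integral w G (d : R) a h (s : R) :
  mu.-integrable Omega (EFin \o w) ->
  (forall i, mu.-integrable Omega (EFin \o (fun x => G x ord0 i))) ->
  is_weak_gradient Omega w G -> 0 < d ->
  (forall y, `|y - (a + s *: h)| <= d -> Omega y) ->
  is_derive s 1
    (fun t => \int[mu]_(y in Omega) (w y * translated_bump d (a + t *: h) y))
    (\int[mu]_(y in Omega) (dotp h (G y) * translated_bump d (a + s *: h) y)).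
Proof.
move=> iw iG wG d0 dO.
have [db ddb idb] := infinitely_derivable_bump d.
have cdb := continuous_infinitely_derivable idb.
have cb := continuous_infinitely_derivable (infinitely_derivable_bump d).
pose B := tensor (fun _ : 'I_n => bump d).
pose D i := tensor (replace (fun _ : 'I_n => bump d) (fun=> db) i).
have tB t y : translated_bump d (a + t *: h) y = B ((y - a) + t *: - h).
  apply: eq_bigr => i _; rewrite !mxE; congr bump; ring.
have dB y (t : R) : is_derive t 1 (fun t => translated_bump d (a + t *: h) y)
    (\sum_i - h ord0 i * D i (y - (a + t *: h))).
  under eq_fun do rewrite tB.
  apply/is_derive_line.
  have -> : y - (a + t *: h) = y - a + t *: - h by rewrite opprD addrA scalerN.
  have := is_derive_tensor (y - a + t *: - h) (- h) (fun=> ddb).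
  by congr is_derive; apply: eq_bigr => i _; rewrite mxE.
have cD i : continuous (D i).
  by apply: continuous_tensor => j; rewrite /replace; case: ifP.
have /choice[C hC] : forall i, exists C : R, 0 <= C /\ forall y, `|D i y| <= C.
  move=> i.
  (* [derive_bump_eq0] requires [d] to be strictly exceeded, while [tensor_bounded] asks for
     vanishing from the radius on; doubling the radius absorbs the difference. *)
  have [j|||C C0 hC] := @tensor_bounded (replace (fun _ : 'I_n => bump d) (fun=> db) i) (d
    * 2).
  - by rewrite /replace; case: ifP.
  - by rewrite mulr_gt0.
  - move=> j t dt; have dt' : d < `|t| by apply: lt_le_trans dt; rewrite ltr_pMr// ltr1n.
    by rewrite /replace; case: ifP => _; [exact: derive_bump_eq0 dt'|exact/bump_eq0/ltW].
  by exists C.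
pose f t y := w y * translated_bump d (a + t *: h) y.
(* [M] bounds the time derivative of the bump uniformly in time and space, so [|w y| * M]
   dominates. *)
pose M := \sum_i `|h ord0 i| * C i.
have M0 : 0 <= M by apply: sumr_ge0 => i _; rewrite mulr_ge0//; have [] := hC i.
have df y (t : R) : is_derive t 1 (f ^~ y) (w y * \sum_i - h ord0 i * D i (y - (a + t *:
  h))).
  exact: (is_deriveZ (w y) (dB y t)).
have d1f t y : partial1of2 f t y = w y * \sum_i - h ord0 i * D i (y - (a + t *: h)).
  by rewrite partial1of2E; exact: derive_val.
have If t : `]s - 1, s + 1[%classic t -> mu.-integrable Omega (EFin \o f t).
  by move=> _; apply: (integrableM_continuous Omega_open Omega_bounded) => //;
    exact: continuous_translated_bump.
have Is : `]s - 1, s + 1[%classic s by rewrite /= in_itv/= ltrBlDr ltrDl ltr01.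
have derf t y : `]s - 1, s + 1[%classic t -> Omega y -> derivable (f ^~ y) t 1.
  by move=> _ _; case: (df y t).
have g0 y : 0 <= `|w y| * M by rewrite mulr_ge0.
have ig : mu.-integrable Omega (EFin \o (fun y => `|w y| * M)).
  apply: (integrableM_continuous Omega_open Omega_bounded); last exact: cst_continuous.
  exact: (integrable_abse iw).
have ub t y : `]s - 1, s + 1[%classic t -> Omega y -> `|partial1of2 f t y| <= `|w y| * M.
  move=> _ _; rewrite d1f normrM ler_wpM2l//; apply: le_trans (ler_norm_sum _ _ _) _.
  by apply: ler_sum => i _; rewrite normrM normrN ler_wpM2l//; have [_] := hC i.
have E : \int[mu]_(y in Omega) (dotp h (G y) * translated_bump d (a + s *: h) y) =
         \int[mu]_(y in Omega) (partial1of2 f s y).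
  have iwD i : mu.-integrable Omega (EFin \o (fun y => w y * D i (y - (a + s *: h)))).
    apply: (integrableM_continuous Omega_open Omega_bounded) => // y.
    by apply: continuous_comp; [apply: continuousB;
      [exact: cvg_id|exact: cst_continuous]|exact: cD].
  have iGD i : mu.-integrable Omega (EFin \o (fun y => G y ord0 i * translated_bump d (a +
    s *: h) y)).
    by apply: (integrableM_continuous Omega_open Omega_bounded) => //;
      exact: continuous_translated_bump.
  have -> : partial1of2 f s = (fun y => \sum_i (- h ord0 i) * (w y * D i (y - (a + s *:
    h)))).
    by apply/funext => y; rewrite d1f mulr_sumr; apply: eq_bigr => i _; rewrite mulrCA.
  have -> : (fun y => dotp h (G y) * translated_bump d (a + s *: h) y) =
      (fun y => \sum_i h ord0 i * (G y ord0 i * translated_bump d (a + s *: h) y)).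
    by apply/funext => y; rewrite /dotp mulr_suml; apply: eq_bigr => i _; rewrite mulrA.
  have iZ i (c : R) g : mu.-integrable Omega (EFin \o g) -> mu.-integrable Omega (EFin \o
    (fun y : 'rV[R]_n => c * g y)).
    by move=> ig'; exact: (@integrableZl _ _ _ mu Omega mOmega c _ ig').
  rewrite (Rintegral_sum _ _).2 => [|i]; last exact: iZ.
  rewrite (Rintegral_sum _ _).2 => [|i]; last exact: iZ.
  apply: eq_bigr => i _; rewrite !RintegralZl// mulNr -mulrN; congr (_ * _).
  have db' (j : 'I_n) (t : R) : is_derive t 1 (fun t => bump d (t - (a + s *: h) ord0 j))
    (db (t - (a + s *: h) ord0 j)).
    have dl : is_derive t 1 (fun t : R => t - (a + s *: h) ord0 j) 1.
      by apply: (is_derive_ext (is_deriveB (is_derive_id t (1 : R)) (is_derive_cst _ t 1)))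
        => //; rewrite subr0.
    apply: (is_derive_ext (@is_derive1_comp R (bump d) (fun t : R => t - (a + s *: h) ord0
      j) t _ _ (ddb _) dl)) => //.
    by rewrite mulr1.
  have ED y : D i (y - (a + s *: h)) = partial i (translated_bump d (a + s *: h)) y.
    rewrite (partial_tensor i db'); apply: eq_bigr => j _; rewrite /replace !mxE.
    by case: ifP.
  under [in RHS]eq_Rintegral do rewrite ED.
  rewrite wG ?opprK//.
  apply: (@test_function_tensor _ _ _ d (a + s *: h)) => // [j|j t].
    exact: infinitely_derivable_translated_bump.
  exact: bump_eq0.
split; first exact: (derivable_under_integral mOmega Is If derf g0 ig ub).
rewrite -derive1E E.
exact: (differentiation_under_integral mOmega Is If derf g0 ig ub).
Qed.

Lemma MVT01 (f f' : R -> R) :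
  (forall s : R, 0 <= s <= 1 -> is_derive s 1 f (f' s)) ->
  exists2 c, 0 <= c <= 1 & f 1 - f 0 = f' c.
Proof.
move=> df.
have [||c] := @MVT_segment R f f' 0 1 ler01.
- by move=> c; rewrite in_itv/= => /andP[c0 c1]; apply: df; rewrite !ltW.
- apply: continuous_in_subspaceT => s; rewrite inE/= in_itv/= => /df[ds _].
  exact/differentiable_continuous/derivable1_diffP.
by rewrite in_itv/= => c01; rewrite subr0 mulr1 => ->; exists c.
Qed.

(** The averages [F] are compared with [u] only at the two ends, so continuity of [u] is used only
    there; in between, it is enough that the tube lies in [Omega]. *)
Lemma weak_gradient_lipschitz w G (u : 'rV[R]_n -> R) (K d0 : R) a h :
  W1infty Omega w G ->
  {ae mu, forall x, Omega x -> u x = w x} ->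
  0 <= K -> {ae mu, forall x, Omega x -> enorm (G x) <= K} ->
  0 < d0 -> (forall (s : R) y, 0 <= s <= 1 -> `|y - (a + s *: h)| <= d0 -> Omega y) ->
  {for a, continuous u} -> {for a + h, continuous u} ->
  `|u (a + h) - u a| <= K * enorm h.
Proof.
move=> [Lw LG wG] uw K0 GK d00 tube cua cuh.
have iw := Linfty_integrable Omega_open Omega_bounded Lw.
have iG i := Linfty_integrable Omega_open Omega_bounded (LG i).
apply/ler_addgt0Pr => e e0; have e20 : 0 < e / 2 by rewrite divr_gt0.
have [d1 /= d10 h1] := (nbhs_ballP _ _).1 (cua _ (nbhsx_ballx (u a) _ e20)).
have [d2 /= d20 h2] := (nbhs_ballP _ _).1 (cuh _ (nbhsx_ballx (u (a + h)) _ e20)).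
(* Below [d0] the bumps stay in [Omega]; below [d1] and [d2] the values of [u] under the end bumps
   differ from [u a] and [u (a + h)] by at most [e / 2]. *)
pose d := Num.min d0 (Num.min d1 d2).
have dp : 0 < d by rewrite !lt_min d00 d10 d20.
have tube' (s : R) : 0 <= s <= 1 -> forall y, `|y - (a + s *: h)| <= d -> Omega y.
  by move=> s01 y yd; apply: (tube s y s01); apply: le_trans yd _; rewrite ge_min lexx.
pose Phi s := translated_bump d (a + s *: h).
have cPhi s : continuous (Phi s) by exact: continuous_translated_bump.
have Phi0 s y : 0 <= Phi s y by exact: translated_bump_ge0.
pose F s := \int[mu]_(y in Omega) (w y * Phi s y).
pose c s := \int[mu]_(y in Omega) Phi s y.
have dF (s : R) : 0 <= s <= 1 -> is_derive s 1 F (\int[mu]_(y in Omega) (dotp h (G y) * Phi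
  s y)).
  by move=> s01; apply: is_derive_bump_integral => //; exact: tube'.
(* The mass c of the bump does not change along the segment: this is the
   derivative formula for the function 1, whose weak gradient is 0. *)
have c1 (s : R) : 0 <= s <= 1 -> is_derive s 1 c 0.
  move=> s01.
  have w1 : is_weak_gradient Omega (cst 1) (fun=> 0).
    apply: smooth_weak_gradient => //; first exact: cst_continuous.
      by move=> i; rewrite (_ : (fun _ => _) = cst 0);
        [exact: cst_continuous|apply/funext => x; rewrite mxE].
    by move=> i x; rewrite mxE; exact: is_derive_cst.
  have i1 : mu.-integrable Omega (EFin \o (cst 1 : 'rV[R]_n -> R)).
    by apply: continuous_integrable => //; exact: cst_continuous.
  have i0 (i : 'I_n) : mu.-integrable Omega (EFin \o (fun x : 'rV[R]_n => (0 : 'rV[R]_n)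
    ord0 i)).
    by apply: continuous_integrable => //; rewrite mxE; exact: cst_continuous.
  apply: (is_derive_ext (is_derive_bump_integral i1 i0 w1 dp (tube' s s01))) => [t|].
    by apply: eq_Rintegral => y _; rewrite mul1r.
  rewrite /Rintegral integral0_eq// => y _.
  by rewrite /dotp big1 ?mul0r// => i _; rewrite mxE mulr0.
have cc (s : R) : 0 <= s <= 1 -> c s = c 0.
  move=> /andP[s0 s1]; have [->//|sn0] := eqVneq s 0.
  have [||t _] := @MVT_segment R c (fun=> 0) 0 s s0.
  - by move=> t; rewrite in_itv/= => /andP[t0 ts]; apply: c1;
      rewrite (ltW t0) (le_trans (ltW ts)).
  - apply: continuous_in_subspaceT => t; rewrite inE/= in_itv/= => /andP[t0 ts].
    have [ct _] : is_derive t 1 c 0 by apply: c1; rewrite t0 (le_trans ts).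
    exact/differentiable_continuous/derivable1_diffP.
  by rewrite mul0r => /eqP; rewrite subr_eq0 => /eqP.
have c0 : 0 < c 0.
  by apply: Rintegral_translated_bump_gt0 => //; apply: tube'; rewrite lexx ler01.
have le01 : 0 <= (0 : R) <= 1 by rewrite lexx ler01.
have le11 : 0 <= (1 : R) <= 1 by rewrite lexx ler01.
have idot : mu.-integrable Omega (EFin \o (fun y => dotp h (G y))).
  apply: (Rintegral_sum _ _).1 => i.
  exact: (@integrableZl _ _ _ mu Omega mOmega (h ord0 i) _ (iG i)).
have F01 : `|F 1 - F 0| <= K * enorm h * c 0.
  have [s s01 ->] := MVT01 dF.
  (* The derivative is put in the form of a distance to [0 * c s], so that [weighted_average_dist]
     applies with [k = 0]. *)
  rewrite -(cc s s01) -[X in `|X|]subr0 -(mul0r (c s)).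
  apply: (weighted_average_dist Omega_open Omega_bounded idot) => //.
    by rewrite mulr_ge0// enorm_ge0.
  apply: filterS GK => x GK Ox _; rewrite subr0 mulrC.
  by apply: le_trans (dotp_le_enorm _ _) _; rewrite ler_wpM2l ?enorm_ge0// GK.
have avg (s : R) : 0 <= s <= 1 -> (forall y, `|y - (a + s *: h)| < d -> `|u y - u (a + s *:
  h)| <= e / 2) ->
    `|F s - u (a + s *: h) * c 0| <= e / 2 * c 0.
  move=> s01 ue; rewrite -(cc s s01).
  apply: (weighted_average_dist Omega_open Omega_bounded iw) => //; first exact: ltW.
  apply: filterS uw => x uw Ox Phix; rewrite -uw//; apply: ue.
  exact: translated_bump_neq0 Phix.
have := avg 0 le01; rewrite scale0r addr0 => /(_ _)A0.
have := avg 1 le11; rewrite scale1r => /(_ _)A1.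
have {}A0 : `|F 0 - u a * c 0| <= e / 2 * c 0.
  apply: A0 => y yd; rewrite distrC; apply/ltW/h1; rewrite -ball_normE /= distrC.
  by apply: lt_le_trans yd _; rewrite !ge_min lexx orbT.
have {}A1 : `|F 1 - u (a + h) * c 0| <= e / 2 * c 0.
  apply: A1 => y yd; rewrite distrC; apply/ltW/h2; rewrite -ball_normE /= distrC.
  by apply: lt_le_trans yd _; rewrite !ge_min lexx !orbT.
(* All three estimates carry the factor [c 0], so the goal is multiplied by this positive mass. *)
rewrite -(ler_pM2r c0) -[X in _ * X](ger0_norm (ltW c0)) -normrM mulrBl mulrDl.
move: F01 A0 A1; rewrite (mulrAC e).
move: (F 1) (F 0) (u (a + h) * c 0) (u a * c 0) (K * enorm h * c 0) (e * c 0).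
clear=> p q r s t v; rewrite !ler_norml => /andP[? ?] /andP[? ?] /andP[? ?].
by apply/andP; split; lra.
Qed.

End weak_gradient_line.

(** * Hausdorff measure of Lipschitz boundaries *)

Section boundary_projection.
Context {R : realType} {m : nat}.
Implicit Types (v w x y p e : 'rV[R]_m.+1) (z : 'rV[R]_m).

Lemma closure_enormP (A : set 'rV[R]_m.+1) x :
  closure A x <-> forall d, 0 < d -> exists2 y, A y & enorm (y - x) < d.
Proof.
split=> [clx d d0|h B /nbhs_ballP[d /= d0 dB]].
  have m0 : (0 : R) < m.+1%:R by rewrite ltr0n.
  have [y [Ay]] := clx _ (nbhsx_ballx x _ (divr_gt0 d0 m0)).
  rewrite -ball_normE /= distrC ltr_pdivlMr// mulrC => yd; exists y => //.
  exact: le_lt_trans (enorm_le_norm _) yd.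
have [y Ay yx] := h d d0; exists y; split => //; apply: dB.
by rewrite -ball_normE /= distrC; apply: le_lt_trans yx; exact: norm_le_enorm.
Qed.

Variable Omega : set 'rV[R]_m.+1.
Hypothesis Omega_open : open Omega.

Definition orth e v := v - dotp v e *: e.

Lemma enorm_orth_le e v : enorm e = 1 -> enorm (orth e v) <= 2 * enorm v.
Proof.
move=> e1; apply: le_trans (ler_enormD _ _) _.
rewrite enormN enormZ e1 mulr1.
by have := dotp_le_enorm v e; rewrite e1; lra.
Qed.

Lemma orthB e v w : orth e v - orth e w = orth e (v - w).
Proof. by apply/rowP => i; rewrite /orth dotpBl !mxE; ring. Qed.

Lemma orth_shift e v (t : R) : enorm e = 1 -> orth e (v + t *: e) = orth e v.
Proof.
move=> e1; rewrite /orth dotpDl dotpZl -enorm_sqr e1.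
by apply/rowP => i; rewrite !mxE; ring.
Qed.

(** A point strictly below the graph has a neighbourhood without points of [Omega]. A move of length
    [delta] changes the height by at most [delta] and the graph by at most [2 * |k| * delta], the
    projection being bounded crudely by 2; hence the radius [g / (1 + 2 * |k|)]. *)
Lemma graph_boundary x (r k : R) e (gamma : 'rV[R]_m.+1 -> R) :
  0 < r -> enorm e = 1 ->
  (forall v w, `|gamma v - gamma w| <= k * enorm (v - w)) ->
  (forall y, enorm (y - x) < r -> (Omega y <-> gamma (orth e y) < dotp y e)) ->
  boundary Omega x -> gamma (orth e x) = dotp x e.
Proof.
move=> r0 e1 lg graph; rewrite boundaryE// => -[clx nOx].
have xx : enorm (x - x) < r by rewrite subrr enorm0.
apply/le_anti/andP; split; last first.
  by rewrite leNgt; apply/negP => /(graph _ xx).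
rewrite leNgt; apply/negP => lt.
pose g := gamma (orth e x) - dotp x e.
have g0 : 0 < g by rewrite subr_gt0.
have K0 : 0 < 1 + 2 * `|k| by rewrite ltr_wpDr// mulr_ge0.
have d0 : 0 < Num.min r (g / (1 + 2 * `|k|)) by rewrite lt_min r0 divr_gt0.
have [y Oy] := (closure_enormP _ _).1 clx _ d0.
rewrite lt_min ltr_pdivlMr// => /andP[yr yg].
have := (graph y yr).1 Oy.
have h1 : dotp (y - x) e <= enorm (y - x).
  by apply: le_trans (ler_norm _) _; apply: le_trans (dotp_le_enorm _ _) _;
    rewrite e1 mulr1.
have h2 : gamma (orth e x) - gamma (orth e y) <= `|k| * (2 * enorm (y - x)).
  apply: le_trans (ler_norm _) _; apply: le_trans (lg _ _) _.
  apply: (@le_trans _ _ (`|k| * enorm (orth e x - orth e y))).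
    by rewrite ler_wpM2r ?enorm_ge0// ler_norm.
  by rewrite ler_wpM2l// orthB (enormB y) enorm_orth_le.
by move: h1 yg; rewrite dotpBl /g; lra.
Qed.

(** A small step from [p] along [e] keeps the projection and raises the height, so it enters
    [Omega]. *)
Lemma boundary_graph x (r : R) e (gamma : 'rV[R]_m.+1 -> R) p :
  enorm e = 1 ->
  (forall y, enorm (y - x) < r -> (Omega y <-> gamma (orth e y) < dotp y e)) ->
  enorm (p - x) < r -> gamma (orth e p) = dotp p e -> boundary Omega p.
Proof.
move=> e1 graph pr gp; rewrite boundaryE//; split; last first.
  by move=> /(graph p pr).1; rewrite gp ltxx.
apply/closure_enormP => d d0.
pose s := Num.min d (r - enorm (p - x)) / 2.
have s0 : 0 < s by rewrite divr_gt0// lt_min d0 subr_gt0.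
have sd : s < Num.min d (r - enorm (p - x)) by rewrite ltr_pdivrMr// ltr_pMr ?ltr1n//
  lt_min d0 subr_gt0.
move: sd; rewrite lt_min => /andP[sd sr].
have se : enorm (s *: e) = s by rewrite enormZ e1 mulr1 gtr0_norm.
exists (p + s *: e); last by rewrite addrAC subrr add0r se.
apply/graph.
  rewrite addrAC; apply: le_lt_trans (ler_enormD _ _) _; rewrite se; lra.
rewrite orth_shift// gp dotpDl dotpZl -[X in s * X]enorm_sqr e1; lra.
Qed.

(* Project along the normal direction e onto a coordinate hyperplane
   transverse to e. *)
Lemma boundary_projection x (rho : R) :
  lipschitz_boundary Omega -> boundary Omega x -> 0 < rho ->
  exists (pr : 'rV[R]_m.+1 -> 'rV[R]_m) (C eta : R),
    [/\ 0 < C, 0 < eta,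
        forall v w i, `|pr v ord0 i - pr w ord0 i| <= C * enorm (v - w) &
        forall z, (forall i, `|z ord0 i - pr x ord0 i| <= eta) ->
          exists p, [/\ boundary Omega p, enorm (p - x) < rho & pr p = z]].
Proof.
move=> Olip bx rho0; have [r [k [e [gamma [r0 e1 lg graph]]]]] := Olip x bx.
have gx := graph_boundary r0 e1 lg graph bx.
have /existsP[j ej] : [exists j, e ord0 j != 0].
  apply: contraTT isT => /existsPn h; have : enorm e = 0.
    rewrite (_ : e = 0) ?enorm0//; apply/rowP => i; rewrite mxE.
    by apply/eqP; have := h i; rewrite negbK.
  by move/eqP; rewrite e1 oner_eq0.
(* [pr] slides [v] along [e] until coordinate [j] vanishes and drops that coordinate; [lf] puts a 0
   back and [q] slides along [e] to the graph. So [q] is a right inverse of [pr] with values on the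
   graph. *)
pose pr v : 'rV[R]_m := \row_i (v ord0 (lift j i) - v ord0 j / e ord0 j * e ord0 (lift j
  i)).
pose lf z : 'rV[R]_m.+1 := \row_i if unlift j i is Some i' then z ord0 i' else 0.
pose q z := lf z + (gamma (orth e (lf z)) - dotp (lf z) e) *: e.
have prq z : pr (q z) = z.
  apply/rowP => i; rewrite !mxE liftK unlift_none add0r mulfK//.
  by rewrite addrK.
have lfpr v : lf (pr v) = v - (v ord0 j / e ord0 j) *: e.
  apply/rowP => i; rewrite !mxE; case: unliftP => [i' ->|->]; first by rewrite !mxE.
  by rewrite divfK// subrr.
have oq z : orth e (q z) = orth e (lf z) by rewrite orth_shift.
have gq z : gamma (orth e (q z)) = dotp (q z) e.
  by rewrite oq /q dotpDl dotpZl -[X in _ * X]enorm_sqr e1 expr1n mulr1 addrC subrK.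
have qx : q (pr x) = x.
  have ox : orth e (lf (pr x)) = orth e x by rewrite lfpr -scaleNr orth_shift.
  rewrite /q ox gx lfpr dotpBl dotpZl -enorm_sqr e1 expr1n mulr1.
  by apply/rowP => i; rewrite !mxE; ring.
have lfB z z' : lf z - lf z' = lf (z - z').
  by apply/rowP => i; rewrite !mxE; case: unlift => [?|]; rewrite ?mxE ?subr0.
pose L := 2 + 2 * `|k|.
have L0 : 0 < L by rewrite ltr_wpDr// mulr_ge0.
have qL z z' : enorm (q z - q z') <= L * enorm (lf (z - z')).
  have -> : q z - q z' = lf (z - z') +
     ((gamma (orth e (lf z)) - gamma (orth e (lf z'))) - dotp (lf (z - z')) e) *: e.
    by rewrite -lfB dotpBl; apply/rowP => i; rewrite !mxE; ring.
  apply: le_trans (ler_enormD _ _) _; rewrite enormZ e1 mulr1.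
  have h1 : `|gamma (orth e (lf z)) - gamma (orth e (lf z'))| <= `|k| * (2 * enorm (lf (z -
    z'))).
    apply: le_trans (lg _ _) _.
    apply: (@le_trans _ _ (`|k| * enorm (orth e (lf z) - orth e (lf z')))).
      by rewrite ler_wpM2r ?enorm_ge0// ler_norm.
    by rewrite ler_wpM2l// orthB lfB enorm_orth_le.
  have h2 := dotp_le_enorm (lf (z - z')) e; rewrite e1 mulr1 in h2.
  have h3 := ler_normB (gamma (orth e (lf z)) - gamma (orth e (lf z'))) (dotp (lf (z - z'))
    e).
  rewrite /L; lra.
pose rr := Num.min r rho.
have rr0 : 0 < rr by rewrite lt_min r0 rho0.
(* [L] is the Lipschitz constant of [q] in terms of [lf], [m.+1] comes from comparing the norms, and
   the half makes the final inequality strict. *)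
pose eta := rr / (L * m.+1%:R) / 2.
have Lm0 : 0 < L * m.+1%:R by rewrite mulr_gt0// ltr0n.
have eta0 : 0 < eta by rewrite !divr_gt0.
exists pr, (1 + `|e ord0 j|^-1), eta; split => //.
- move=> v w i; rewrite !mxE.
  have -> : v ord0 (lift j i) - v ord0 j / e ord0 j * e ord0 (lift j i) -
      (w ord0 (lift j i) - w ord0 j / e ord0 j * e ord0 (lift j i)) =
      (v - w) ord0 (lift j i) - (v - w) ord0 j * ((e ord0 j)^-1 * e ord0 (lift j i)).
    by rewrite !mxE; ring.
  apply: le_trans (ler_normB _ _) _; rewrite mulrDl mul1r lerD ?coord_le_enorm//.
  rewrite !normrM normfV mulrC ler_pM ?mulr_ge0 ?invr_ge0 ?coord_le_enorm//.
  by rewrite ler_piMr ?invr_ge0// -e1 coord_le_enorm.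
- move=> z hz; exists (q z).
  have lt : enorm (q z - x) < rr.
    rewrite -[X in q z - X]qx; apply: le_lt_trans (qL _ _) _.
    have h : `|lf (z - pr x)| <= eta.
      rewrite [leLHS]/Num.norm/= mx_normrE; apply: bigmax_le => [|[i' i] _ /=];
        first exact: ltW.
      rewrite !mxE; case: unliftP => [i'' _|_]; last by rewrite normr0 ltW.
      by have := hz i''; rewrite !mxE.
    have h' : L * enorm (lf (z - pr x)) <= L * m.+1%:R * eta.
      rewrite -mulrA ler_wpM2l ?(ltW L0)//; apply: le_trans (enorm_le_norm _) _.
      by rewrite ler_wpM2l.
    apply: le_lt_trans h' _; rewrite /eta mulrA mulrCA divff ?gt_eqF// mulr1.
    by rewrite ltr_pdivrMr// ltr_pMr// ltr1n.
  move: lt; rewrite lt_min => /andP[lr lrho]; split => //.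
  exact: (boundary_graph e1 graph).
Qed.

End boundary_projection.

Section hausdorff_boundary.
Context {R : realType} {m : nat}.
Local Notation mu := (lebesgue_rV R m).

Lemma le_ediam n (U : set 'rV[R]_n) x y : U x -> U y -> ((enorm (x - y))%:E <= ediam U)%E.
Proof.
move=> Ux Uy; rewrite /ediam le_max; apply/orP; right; apply: ereal_sup_ubound.
by exists x => //; exists y.
Qed.

Lemma ediam_ge0 n (U : set 'rV[R]_n) : (0 <= ediam U)%E.
Proof. by rewrite /ediam le_max lexx. Qed.

(* A covering of A of small Hausdorff content projects to a covering of a box
   by small boxes, contradicting the subadditivity of Lebesgue measure. *)
Lemma hausdorff_neq0 n (A : set 'rV[R]_n) (pr : 'rV[R]_n -> 'rV[R]_m)
    (C eta : R) (c : 'rV[R]_m) :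
  0 < C -> 0 < eta ->
  (forall v w i, `|pr v ord0 i - pr w ord0 i| <= C * enorm (v - w)) ->
  (forall z : 'rV[R]_m, (forall i, `|z ord0 i - c ord0 i| <= eta) ->
     exists2 p, A p & pr p = z) ->
  hausdorff m A <> 0%E.
Proof.
move=> C0 eta0 prC surj H0.
have C20 : 0 < C * 2 by rewrite mulr_gt0.
(* The target box has volume [(eta * 2) ^+ m], and a piece of diameter [d k] projects into a box of
   volume [(C * 2 * d k) ^+ m]. *)
pose eps := (eta * 2) ^+ m / (C * 2) ^+ m.
have eps0 : 0 < eps by rewrite divr_gt0// exprn_gt0// mulr_gt0.
(* Any scale would do; the bound 1 makes the diameters of the covering sets finite. *)
have : (hausdorff_pre m 1 A < eps%:E)%E.
  apply: (@le_lt_trans _ _ 0%E); last by rewrite lte_fin.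
  by rewrite -H0; apply: ereal_sup_ubound; exists 1; rewrite //= ltr01.
move=> /ereal_inf_lt[_ [F [AF F1] <-]]; apply/negP; rewrite -leNgt.
have Ffin k : ediam (F k) \is a fin_num.
  by rewrite ge0_fin_numE ?ediam_ge0// (le_lt_trans (F1 k))// ltry.
pose d k := fine (ediam (F k)).
have d0 k : 0 <= d k by rewrite fine_ge0// ediam_ge0.
have Fd k v w : F k v -> F k w -> enorm (v - w) <= d k.
  by move=> Fv Fw; rewrite -lee_fin fineK// le_ediam.
have /choice[B hB] : forall k, exists B : set 'rV[R]_m,
    [/\ measurable B, pr @` F k `<=` B & (mu B <= ((C * 2) ^+ m)%:E * ediam (F k) ^+ m)%E].
  move=> k; have [[p Fp]|F0] := pselect (F k !=set0); last first.
    exists set0; split => //; first by move=> y [v Fv vy]; apply: F0; exists v.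
    rewrite measure0; apply: mule_ge0; first by rewrite lee_fin exprn_ge0// ltW.
    by apply: expe_ge0; exact: ediam_ge0.
  pose r : 'rV[R]_m := const_mx (C * d k).
  exists [set v | forall i, (pr p - r) ord0 i <= v ord0 i <= (pr p + r) ord0 i]; split.
  - exact: measurable_rV_box.
  - move=> _ [v Fv <-] i; rewrite !mxE -ler_distl.
    by apply: le_trans (prC _ _ _) _; rewrite ler_wpM2l ?(ltW C0)// Fd.
  rewrite lebesgue_rV_box => [|i]; last first.
    by rewrite !mxE lerBlDr -addrA lerDl addr_ge0// mulr_ge0// ltW.
  rewrite -(fineK (Ffin k)) -EFin_expe -EFinM lee_fin -exprMn.
  rewrite (eq_bigr (fun=> C * 2 * d k)) => [|i _]; last by rewrite !mxE; ring.
  by rewrite prodr_const card_ord.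
pose r : 'rV[R]_m := const_mx eta.
pose Q := [set v : 'rV[R]_m | forall i, (c - r) ord0 i <= v ord0 i <= (c + r) ord0 i].
have muQ : mu Q = ((eta * 2) ^+ m)%:E.
  rewrite lebesgue_rV_box => [|i]; last by rewrite !mxE; lra.
  rewrite (eq_bigr (fun=> eta * 2)) => [|i _]; last by rewrite !mxE; ring.
  by rewrite prodr_const card_ord.
have QB : Q `<=` \bigcup_k B k.
  move=> z Qz; have [i|p Ap <-] := surj z.
    by rewrite ler_distl; have := Qz i; rewrite !mxE.
  have [k _ Fkp] := AF p Ap; exists k => //.
  by have [_ + _] := hB k; apply; exists p.
have : (mu Q <= \sum_(k <oo) mu (B k))%E.
  apply: measure_sigma_subadditive => //; last exact: measurable_rV_box.
  by move=> k; case: (hB k).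
rewrite muQ => /le_trans h.
have : (((eta * 2) ^+ m)%:E <= ((C * 2) ^+ m)%:E * \sum_(k <oo) ediam (F k) ^+ m)%E.
  apply: h; rewrite -nneseriesZl => [|k _]; last by rewrite expe_ge0// ediam_ge0.
  by apply: lee_nneseries => [k _ _|k _]; [exact: measure_ge0|case: (hB k)].
by rewrite -lee_pdivrMl ?exprn_gt0// -EFinM mulrC.
Qed.

Lemma ediam0 n : ediam (@set0 'rV[R]_n) = 0%E.
Proof.
rewrite /ediam (_ : [set _ | _ in _ & _ in _] = set0).
  by rewrite ereal_sup0 maxeNy.
by rewrite -subset0 => y [].
Qed.

(** Cover by empty sets. For [s = 0] each of them would contribute [0 ^+ 0 = 1]. *)
Lemma hausdorff0 n (s : nat) : (0 < s)%N -> hausdorff s (@set0 'rV[R]_n) = 0%E.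
Proof.
move=> s0; have pre0 (d : R) : 0 < d -> hausdorff_pre s d (@set0 'rV[R]_n) = 0%E.
  move=> d0; apply/le_anti/andP; split.
    apply: ereal_inf_lbound; exists (fun=> set0).
      by split; [exact: sub0set|move=> k; rewrite ediam0 lee_fin ltW].
    by apply: eseries0 => k _ _; rewrite ediam0; apply/eqP; rewrite expe_eq0 s0 eqxx.
  apply: le_ereal_inf_tmp => _ [F _ <-]; apply: nneseries_ge0 => k _ _.
  by rewrite expe_ge0// ediam_ge0.
rewrite /hausdorff -(@ereal_sup1 R 0); congr ereal_sup.
apply/seteqP; split => [_ [d d0 <-]|_ ->]; first exact: pre0.
by exists 1; [exact: ltr01|apply: pre0; exact: ltr01].
Qed.

Lemma boundary_trace_le (Omega : set 'rV[R]_m.+1) (u T : 'rV[R]_m.+1 -> R) (M : R) :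
  open Omega -> lipschitz_boundary Omega ->
  {within closure Omega, continuous u} ->
  (forall x, boundary Omega x -> T x = u x) ->
  hausdorff m (boundary Omega `&` [set x | M < `|T x|]) = 0%E ->
  forall x, boundary Omega x -> `|u x| <= M.
Proof.
move=> oO Olip cu Tu H0 x bx; rewrite leNgt; apply/negP => Mx.
have clx : closure Omega x by case: bx.
have : within (closure Omega) (nbhs x) [set y | M < `|u y|].
  have := (subspace_continuousP _ _).1 cu x clx.
  move=> /(_ [set t | M < `|t|]); apply; apply: open_nbhs_nbhs; split => //.
  have : open (Num.norm @^-1` [set t : R | M < t] : set R).
    by apply: open_comp => [t _|]; [exact: norm_continuous|exact: open_gt].
  by [].
move=> /nbhs_ballP[rho /= rho0 h].
have [pr [C [eta [C0 eta0 prC surj]]]] := boundary_projection oO Olip bx rho0.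
apply: (hausdorff_neq0 C0 eta0 prC _ H0) => z /surj[p [bp px <-]].
exists p => //; split => //=; rewrite Tu//; apply: h; last by case: bp.
by rewrite -ball_normE /= distrC; apply: le_lt_trans px; exact: norm_le_enorm.
Qed.

End hausdorff_boundary.

(** * Lower bound *)

Section lower_bound.
Context {R : realType} {n : nat}.
Variable Omega : set 'rV[R]_n.+1.
Hypothesis Omega0 : Omega !=set0.
Hypothesis Omega_open : open Omega.
Hypothesis Omega_bounded : bounded_set Omega.
Hypothesis Omega_lip : lipschitz_boundary Omega.
Local Notation mu := (lebesgue_rV R n.+1).

(** The segment towards a nearest boundary point [y] stays in the ball of radius [D] around [x],
    which lies in [Omega]; the Lipschitz estimate is applied to a part of it and continuity at [y]
    covers the rest. *)
Lemma W1infty_bound w G (u : 'rV[R]_n.+1 -> R) (K c : R) :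
  W1infty Omega w G -> {within closure Omega, continuous u} ->
  {ae mu, forall x, Omega x -> u x = w x} ->
  0 <= K -> {ae mu, forall x, Omega x -> enorm (G x) <= K} ->
  (forall y, boundary Omega y -> `|u y| <= c) ->
  forall x, Omega x -> `|u x| <= c + K * bdist Omega x.
Proof.
move=> wG cu uw K0 GK uc x Ox.
have cuO y : Omega y -> {for y, continuous u}.
  move=> Oy; have : {within Omega, continuous u}.
    by apply: continuous_subspaceW cu; exact: subset_closure.
  by rewrite continuous_open_subspace// => /(_ y); apply; rewrite inE.
have [y bdy dxy] := bdist_attained Omega_open Omega_bounded Omega0 (ltn0Sn n) x.
have D0 := bdist_gt0 Omega_open Omega_bounded Omega0 (ltn0Sn n) Ox.
set D := bdist Omega x in dxy D0 *.
apply/ler_addgt0Pr => e e0.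
have clyx : closure Omega y by case: bdy.
have : within (closure Omega) (nbhs y) [set z | `|u y - u z| < e].
  have := (subspace_continuousP _ _).1 cu y clyx.
  by move=> /(_ (ball (u y) e)); rewrite -ball_normE; apply; rewrite ball_normE;
    exact: nbhsx_ballx.
move=> /nbhs_ballP[rho /= rho0 hrho].
(* The shortened segment ends at distance [(1 - t) * D < rho] from [y], where [u] is within [e] of
   [u y], and it leaves the margin [(1 - t) * D] inside the ball of radius [D]. *)
pose t := 1 - Num.min 1 (rho / D) / 2.
have min0 : 0 < Num.min 1 (rho / D) by rewrite lt_min ltr01 divr_gt0.
have min1 : Num.min 1 (rho / D) <= 1 by rewrite ge_min lexx.
have minr : Num.min 1 (rho / D) * D <= rho by rewrite -ler_pdivlMr// ge_min lexx orbT.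
have t0 : 0 <= t by rewrite /t; lra.
have t1 : 0 < 1 - t by rewrite /t; lra.
have t1D : (1 - t) * D < rho.
  have : 0 < Num.min 1 (rho / D) * D by rewrite mulr_gt0.
  by rewrite /t; lra.
have tD0 : 0 < (1 - t) * D by rewrite mulr_gt0.
pose h := t *: (y - x).
have eh : enorm h = t * D by rewrite enormZ ger0_norm// enormB dxy.
(* In dimension [n.+1] a maximum-norm distance [d0] is a Euclidean distance at most [n.+1%:R * d0],
   strictly below the margin. *)
pose d0 := (1 - t) * D / n.+2%:R.
have d00 : 0 < d0 by rewrite divr_gt0// ltr0n.
have tube (s : R) z : 0 <= s <= 1 -> `|z - (x + s *: h)| <= d0 -> Omega z.
  move=> /andP[s0 s1] zd.
  apply: (bdist_ball Omega_open Ox); rewrite -/D.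
  have -> : z - x = (z - (x + s *: h)) + s *: h by apply/rowP => i; rewrite !mxE; ring.
  apply: le_lt_trans (ler_enormD _ _) _; rewrite enormZ (ger0_norm s0) eh.
  have h1 : enorm (z - (x + s *: h)) < (1 - t) * D.
    apply: le_lt_trans (enorm_le_norm _) _.
    apply: (@le_lt_trans _ _ (n.+1%:R * d0)); first by rewrite ler_wpM2l.
    by rewrite /d0 mulrCA gtr_pMr// ltr_pdivrMr ?ltr0n// mul1r ltr_nat.
  have h2 : s * (t * D) <= t * D by rewrite ler_piMl// mulr_ge0// ltW.
  lra.
have Oxh : Omega (x + h).
  by apply: (tube 1); rewrite ?lexx ?ler01// scale1r subrr normr0 ltW.
have := weak_gradient_lipschitz Omega_open Omega_bounded wG uw K0 GK d00 tube (cuO _ Ox)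
  (cuO _ Oxh).
rewrite eh => h1.
have h2 : `|u y - u (x + h)| < e.
  apply: hrho; last exact: subset_closure.
  rewrite -ball_normE /=; apply: le_lt_trans (norm_le_enorm _) _.
  have -> : y - (x + h) = (1 - t) *: (y - x) by apply/rowP => i; rewrite !mxE; ring.
  by rewrite enormZ gtr0_norm// enormB -dxy.
have h3 := uc y bdy.
have h4 : K * (t * D) <= K * D by rewrite ler_wpM2l// ler_piMl ?(ltW D0)// -subr_ge0 ltW.
have := ler_normB (u (x + h)) (u (x + h) - u x).
rewrite opprB addrC subrK => h5.
have := ler_normB (u y) (u y - u (x + h)).
rewrite opprB addrC subrK => h6.
lra.
Qed.

Lemma Lambda_infty_ge (beta : R) : 0 < beta ->
  ((1 / (1 / beta + inradius Omega))%:E <= Lambda_infty Omega beta)%E.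
Proof.
move=> beta0; apply: le_ereal_inf_tmp => _ [w [G [T [wG [u [cu uw Tu]] w1 ->]]]].
set N1 := Linfty_norm _ _; set N2 := Linfty_norm_boundary _ _.
have [x0 Ox0 x0R] := inradius_attained Omega_open Omega_bounded Omega0 (ltn0Sn n).
have R0 : 0 < inradius Omega by rewrite -x0R;
  exact: (bdist_gt0 Omega_open Omega_bounded Omega0).
set b := 1 / beta + _; have b0 : 0 < b by rewrite addr_gt0// divr_gt0.
rewrite leNgt; apply/negP => lt.
have N10 : (0 <= N1)%E by exact: Linfty_norm_ge0.
have mx0 : (0 <= maxe N1 (beta%:E * N2))%E by rewrite le_max N10.
have mxfin : maxe N1 (beta%:E * N2)%E \is a fin_num.
  by rewrite ge0_fin_numE// (lt_trans lt)// ltry.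
pose l0 := fine (maxe N1 (beta%:E * N2)%E).
have l00 : 0 <= l0 by rewrite fine_ge0.
have l0b : l0 < 1 / b by rewrite -lte_fin fineK.
(* Strictly above the energy, [L] yields some [M < L / beta] in the infimum defining the boundary
   norm; strictly below [1 / b], it gives [L * b < 1], against the norm of [w] being 1. *)
pose L := (l0 + 1 / b) / 2.
have Lb : L < 1 / b by rewrite /L; lra.
have l0L : l0 < L by rewrite /L; lra.
have L0 : 0 <= L by rewrite (le_trans l00)// ltW.
have mxL : (maxe N1 (beta%:E * N2) < L%:E)%E by rewrite -(fineK mxfin) lte_fin.
move: mxL; rewrite gt_max => /andP[N1L N2L].
have GL : {ae mu, forall x, Omega x -> enorm (G x) <= L}.
  have := (Linfty_norm_leP Omega (fun x => enorm (G x)) L0).1 (ltW N1L).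
  by apply: filterS => x + Ox => /(_ Ox); rewrite ger0_norm ?enorm_ge0.
have N2L' : (N2 < (L / beta)%:E)%E.
  by move: N2L; rewrite -lte_pdivlMl// -EFinM mulrC.
have [_ [M [M0 HM] <-]] := ereal_inf_lt N2L'; rewrite lte_fin => ML.
have uM y : boundary Omega y -> `|u y| <= L / beta.
  by move=> by_; rewrite (le_trans _ (ltW ML))//;
    exact: (boundary_trace_le Omega_open Omega_lip cu Tu HM).
have uL := W1infty_bound wG cu uw L0 GL uM.
have : (Linfty_norm Omega w <= (L * b)%:E)%E.
  apply/Linfty_norm_leP; first by rewrite mulr_ge0// ltW.
  apply: filterS uw => x uw Ox; rewrite -uw//; apply: le_trans (uL x Ox) _.
  rewrite /b mulrDr mul1r lerD2l ler_wpM2l//.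
  exact: bdist_le_inradius.
rewrite w1 lee_fin leNgt => /negP; apply.
by rewrite -ltr_pdivlMr.
Qed.

End lower_bound.

(** * Upper bound *)

Section soft_cone.
Context {R : realType} {n : nat}.
Variables (x0 : 'rV[R]_n) (r e : R).
Hypothesis e_gt0 : 0 < e.
Implicit Types (s t : R) (x : 'rV[R]_n).

(* Smooth approximations of |s| and max (s, 0) at scale e. *)
Definition soft_abs s : R := Num.sqrt (s ^+ 2 + e ^+ 2).

Definition soft_pos s : R := (s + soft_abs s) / 2.

Definition soft_pos' s : R := (1 + s / soft_abs s) / 2.

Lemma soft_abs_arg_gt0 s : 0 < s ^+ 2 + e ^+ 2.
Proof. by rewrite ltr_wpDl ?sqr_ge0// exprn_gt0. Qed.

Lemma soft_abs_gt0 s : 0 < soft_abs s.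
Proof. by rewrite sqrtr_gt0 soft_abs_arg_gt0. Qed.

Lemma ler_soft_abs s t : `|s| <= `|t| -> soft_abs s <= soft_abs t.
Proof.
move=> st; rewrite ler_wsqrtr// lerD2r -(real_normK (num_real s)) -(real_normK (num_real
  t)).
by rewrite ler_pXn2r// nnegrE.
Qed.

Lemma soft_abs0 : soft_abs 0 = e.
Proof. by rewrite /soft_abs expr0n add0r sqrtr_sqr gtr0_norm. Qed.

Lemma le_soft_abs s : `|s| <= soft_abs s.
Proof. by rewrite -sqrtr_sqr ler_wsqrtr// lerDl sqr_ge0. Qed.

Lemma soft_abs_le s : soft_abs s <= `|s| + e.
Proof.
rewrite -(ler_pXn2r (n := 2)) ?nnegrE ?addr_ge0 ?(ltW e_gt0) ?(ltW (soft_abs_gt0 _))//.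
rewrite sqr_sqrtr ?(ltW (soft_abs_arg_gt0 _))// sqrrD real_normK ?num_real//.
by rewrite lerD2r lerDl mulrn_wge0// mulr_ge0// ltW.
Qed.

Lemma soft_pos_ge0 s : 0 <= soft_pos s.
Proof. by rewrite /soft_pos; have := le_soft_abs s; rewrite ler_norml => /andP[? _];
  lra. Qed.

Lemma soft_pos_ge s : s <= soft_pos s.
Proof. by rewrite /soft_pos; have := le_soft_abs s; rewrite ler_norml => /andP[_ ?];
  lra. Qed.

Lemma soft_pos_le s : s <= 0 -> soft_pos s <= e / 2.
Proof. by move=> s0; rewrite /soft_pos; have := soft_abs_le s; rewrite ler0_norm//;
  lra. Qed.

Lemma soft_pos'_ge0 s : 0 <= soft_pos' s.
Proof.
have := le_soft_abs s; rewrite /soft_pos' ler_norml => /andP[h _].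
have : -1 <= s / soft_abs s by rewrite ler_pdivlMr ?soft_abs_gt0// mulN1r.
lra.
Qed.

Lemma soft_pos'_le1 s : soft_pos' s <= 1.
Proof.
have := le_soft_abs s; rewrite /soft_pos' ler_norml => /andP[_ h].
have : s / soft_abs s <= 1 by rewrite ler_pdivrMr ?soft_abs_gt0// mul1r.
lra.
Qed.

Lemma is_derive_soft_abs s : is_derive s 1 soft_abs (s / soft_abs s).
Proof.
have dp : is_derive s 1 (fun t : R => t ^+ 2 + e ^+ 2) (2 * s).
  apply: (is_derive_ext (is_deriveD (is_deriveX 2 (is_derive_id s (1 : R))) (is_derive_cst
    _ s 1))) => //.
  by rewrite addr0 [LHS]mulr1 expr1.
have ds := is_derive1_sqrt (soft_abs_arg_gt0 s).
apply: (is_derive_ext (@is_derive1_comp R Num.sqrt (fun t : R => t ^+ 2 + e ^+ 2) s _ _ ds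
  dp)) => //.
rewrite -/(soft_abs s); field.
by rewrite gt_eqF// soft_abs_gt0.
Qed.

Lemma is_derive_soft_pos s : is_derive s 1 soft_pos (soft_pos' s).
Proof.
have d1 := is_deriveZ (2^-1 : R) (is_deriveD (is_derive_id s (1 : R)) (is_derive_soft_abs
  s)).
by apply: (is_derive_ext d1) => [t|]; rewrite [LHS]mulrC.
Qed.

Lemma continuous_soft_abs : continuous soft_abs.
Proof.
move=> s; apply/differentiable_continuous/derivable1_diffP.
by case: (is_derive_soft_abs s).
Qed.

Lemma ler_soft_pos s t : s <= t -> soft_pos s <= soft_pos t.
Proof.
move=> st.
have [||c _] := @MVT_segment R soft_pos soft_pos' s t st.
- by move=> c _; exact: is_derive_soft_pos.
- apply: continuous_subspaceT => c; apply/differentiable_continuous/derivable1_diffP.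
  by case: (is_derive_soft_pos c).
by move=> E; rewrite -subr_ge0 E mulr_ge0 ?soft_pos'_ge0// subr_ge0.
Qed.

(** [soft_abs] rounds the vertex at [x0] and [soft_pos] the edge where the cone is cut off. *)
Definition soft_cone x : R := soft_pos (r - soft_abs (enorm (x - x0))).

(** The gradient of [soft_cone] is [- soft_cone_slope] times [x - x0]; as [soft_abs] never vanishes,
    this makes sense at [x0] too. *)
Definition soft_cone_slope t : R := soft_pos' (r - soft_abs t) / soft_abs t.

Lemma continuous_dist : continuous (fun x => enorm (x - x0)).
Proof.
apply: (@lipschitz_continuous _ _ _ 1) => x y; rewrite mul1r.
apply: le_trans (ler_enorm_dist _ _) _.
by rewrite opprB addrA subrK.
Qed.

Lemma continuous_soft_cone : continuous soft_cone.
Proof.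
have cf : continuous (fun t => soft_pos (r - soft_abs t)).
  move=> t.
  have cp : {for (r - soft_abs t), continuous soft_pos}.
    apply/differentiable_continuous/derivable1_diffP.
    by case: (is_derive_soft_pos (r - soft_abs t)).
  apply: (@continuous_comp _ _ _ (fun t => r - soft_abs t) soft_pos) cp.
  by apply: cvgB; [exact: cvg_cst|exact: continuous_soft_abs].
move=> x.
exact: (continuous_comp (@continuous_dist x) (cf _)).
Qed.

Lemma continuous_soft_cone_slope : continuous soft_cone_slope.
Proof.
have cq : continuous (fun s => (soft_abs s)^-1).
  move=> s; apply: cvgV; last exact: continuous_soft_abs.
  by rewrite gt_eqF// soft_abs_gt0.
have cp' : continuous soft_pos'.
  move=> s; apply: (@cvgMr_tmp _ _ _ _ (fun s => 1 + s / soft_abs s)).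
  apply: cvgD; first exact: cvg_cst.
  by apply: (@cvgM _ _ _ _ id); [exact: cvg_id|exact: cq].
move=> t; apply: (@cvgM _ _ _ _ (fun t => soft_pos' (r - soft_abs t))); last exact: cq.
apply: (@continuous_comp _ _ _ (fun t => r - soft_abs t) soft_pos'); last exact: cp'.
by apply: cvgB; [exact: cvg_cst|exact: continuous_soft_abs].
Qed.

Lemma is_derive_soft_cone x (i : 'I_n) :
  is_derive x (delta_mx ord0 i) soft_cone
    (- (soft_cone_slope (enorm (x - x0)) * (x - x0) ord0 i)).
Proof.
set v : 'rV[R]_n := delta_mx ord0 i.
have := (is_derive_line soft_cone x v 0 (- (soft_cone_slope (enorm (x - x0)) * (x - x0)
  ord0 i))).2.
rewrite scale0r addr0; apply.
have av : dotp (x - x0) v = (x - x0) ord0 i.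
  rewrite /dotp (bigD1 i)//= big1 ?addr0 => [|j ji]; rewrite [v _ _]mxE !eqxx ?mulr1//.
  by rewrite (negbTE ji) mulr0.
pose a := (x - x0) ord0 i; pose K := enorm (x - x0) ^+ 2 + e ^+ 2.
have K0 : 0 < K by exact: soft_abs_arg_gt0.
(* The Euclidean norm is not differentiable at [x0], but along the line its square plus [e ^+ 2] is
   this positive quadratic, whose square root is. *)
pose p (t : R) := t * (t * dotp v v + 2 * a) + K.
have pE t : enorm (x + t *: v - x0) ^+ 2 + e ^+ 2 = p t.
  have -> : x + t *: v - x0 = (x - x0) + t *: v by rewrite addrAC.
  have -> (y : 'rV[R]_n) : enorm (y + t *: v) ^+ 2 =
      enorm y ^+ 2 + 2 * t * dotp y v + t * t * dotp v v.
    by rewrite !enorm_sqr !(dotpDl, dotpDr, dotpZl, dotpZr) (dotpC v y); ring.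
  by rewrite av /p /K /a; ring.
have dp : is_derive (0 : R) 1 p (2 * a).
  have d1 := is_deriveD (is_deriveZ (dotp v v) (is_derive_id (0 : R) (1 : R)))
    (is_derive_cst (2 * a) (0 : R) (1 : R)).
  have d2 := is_deriveD (is_deriveM (is_derive_id (0 : R) (1 : R)) d1) (is_derive_cst K (0
    : R) (1 : R)).
  apply: (is_derive_ext d2) => [t|] /=.
    by rewrite /p !fctE /= [dotp v v *: t]mulrC.
  by rewrite scale0r add0r addr0 [LHS]mulr1 !fctE /= scaler0 add0r.
have p0 : p 0 = K by rewrite /p mul0r add0r.
have dq : is_derive (0 : R) 1 (Num.sqrt \o p) (a / soft_abs (enorm (x - x0))).
  have ds : is_derive (p 0) 1 Num.sqrt (2 * Num.sqrt K)^-1 by rewrite p0;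
    exact: is_derive1_sqrt.
  apply: (is_derive_ext (is_derive1_comp ds dp)) => //.
  rewrite -/(soft_abs (enorm (x - x0))); field.
  by rewrite gt_eqF// soft_abs_gt0.
have ds : is_derive (0 : R) 1 (fun t => r - Num.sqrt (p t)) (- (a / soft_abs (enorm (x -
  x0)))).
  apply: (is_derive_ext (is_deriveB (is_derive_cst r (0 : R) 1) dq)) => //.
  by rewrite sub0r.
have df := is_derive_soft_pos (r - Num.sqrt (p 0)).
apply: (is_derive_ext (@is_derive1_comp R soft_pos (fun t => r - Num.sqrt (p t)) 0 _ _ df
  ds)) => [t /=|].
  by rewrite /soft_cone /soft_abs pE.
by rewrite p0 /soft_cone_slope -/(soft_abs (enorm (x - x0))) /a; ring.
Qed.

End soft_cone.

(** * Normalized smooth cones as competitors *)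

Section upper_bound.
Context {R : realType} {n : nat}.
Variable Omega : set 'rV[R]_n.
Hypothesis n_gt1 : (1 < n)%N.
Hypothesis Omega0 : Omega !=set0.
Hypothesis Omega_open : open Omega.
Hypothesis Omega_bounded : bounded_set Omega.
Local Notation mu := (lebesgue_rV R n).

(** If the value at [x] exceeded the norm, so would the values on a nonempty open set, which is not
    null. *)
Lemma Linfty_norm_ge (w : 'rV[R]_n -> R) x : continuous w -> Omega x ->
  (`|w x|%:E <= Linfty_norm Omega w)%E.
Proof.
move=> cw Ox; rewrite leNgt; apply/negP => lt.
have Nfin : Linfty_norm Omega w \is a fin_num.
  by rewrite ge0_fin_numE ?Linfty_norm_ge0// (lt_trans lt)// ltry.
pose c := fine (Linfty_norm Omega w).
have c0 : 0 <= c by rewrite fine_ge0// Linfty_norm_ge0.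
have cx : c < `|w x| by rewrite -lte_fin fineK.
have [|N [mN N0 sub]] := (Linfty_norm_leP Omega w c0).1; first by rewrite fineK.
pose U := Omega `&` (Num.norm \o w) @^-1` [set t | c < t].
have oU : open U.
  apply: openI => //; apply: open_comp => [y _|]; last exact: open_gt.
  by apply: continuous_comp; [exact: cw|exact: norm_continuous].
have : (0 < mu U)%E by apply: lebesgue_rV_open_gt0 => //; exists x.
apply/negP; rewrite -leNgt -N0; apply: le_measure; rewrite ?inE//.
  exact: open_measurable_rV.
move=> y [Oy /= cy]; apply: sub => /= /(_ Oy).
by rewrite leNgt cy.
Qed.

Lemma Linfty_norm_boundary_le (T : 'rV[R]_n -> R) (M : R) : 0 <= M ->
  (forall x, boundary Omega x -> `|T x| <= M) ->
  (Linfty_norm_boundary Omega T <= M%:E)%E.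
Proof.
move=> M0 TM; apply: ereal_inf_lbound; exists M => //; split=> //.
(* The exceptional set is empty, and [n_gt1] makes the dimension [n.-1] of the Hausdorff measure
   positive. *)
rewrite (_ : _ `&` _ = set0); first by apply: hausdorff0; rewrite -subn1 subn_gt0.
by rewrite -subset0 => x [/TM /=]; rewrite leNgt => /negP.
Qed.

(** The denominator is a lower bound for the maximum [M] of [f], since [soft_abs] at 0 is [e]. The
    numerator is [beta] times the bound [1 / beta + e / 2] for [f] on the boundary, where the
    distance to [x0] is at least [r] and [soft_pos] is at most [e / 2]. *)
Lemma Lambda_infty_le_approx (beta e : R) : 0 < beta -> 0 < e < inradius Omega ->
  (Lambda_infty Omega beta <=
   ((1 + beta * (e / 2)) / (1 / beta + inradius Omega - e))%:E)%E.
Proof.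
move=> beta0 /andP[e0 eR]; set r := inradius Omega in eR *.
have n0 : (0 < n)%N by apply: ltn_trans n_gt1.
have [x0 Ox0 x0R] := inradius_attained Omega_open Omega_bounded Omega0 n0.
have ib0 : 0 < 1 / beta by rewrite divr_gt0.
pose f x := 1 / beta + soft_cone x0 r e x.
pose M := f x0.
have fM x : f x <= M.
  rewrite lerD2l; apply: ler_soft_pos => //; rewrite lerD2l lerN2.
  by apply: ler_soft_abs; rewrite subrr enorm0 normr0.
have f0 x : 0 <= f x by rewrite addr_ge0 ?(ltW ib0)// soft_pos_ge0.
have Mge : 1 / beta + r - e <= M.
  rewrite -addrA lerD2l; apply: le_trans (soft_pos_ge _ _).
  by rewrite subrr enorm0 soft_abs0.
have D0 : 0 < 1 / beta + r - e by lra.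
have M0 : 0 < M by apply: lt_le_trans Mge.
pose w x := f x / M.
pose G x := (soft_cone_slope r e (enorm (x - x0)) / M) *: (x0 - x).
have cf : continuous f.
  move=> x; apply: (@continuousD _ _ _ (cst (1 / beta)) (soft_cone x0 r e));
    first exact: cst_continuous.
  exact: (continuous_soft_cone e0).
have cw : continuous w.
  have : continuous (f \* cst M^-1).
    by move=> x; apply: continuousM; [exact: cf|exact: cst_continuous].
  by [].
have w01 x : 0 <= w x <= 1.
  by rewrite /w divr_ge0 ?(ltW M0)//= ler_pdivrMr// mul1r.
have cG i : continuous (fun x => G x ord0 i).
  have -> : (fun x => G x ord0 i) = (fun x : 'rV[R]_n =>
      soft_cone_slope r e (enorm (x - x0)) / M * (x0 ord0 i - x ord0 i)).
    by apply/funext => x; rewrite !mxE.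
  have c1 : continuous (soft_cone_slope r e \o (fun x => enorm (x - x0))).
    move=> x; apply: continuous_comp; first exact: continuous_dist.
    exact: (continuous_soft_cone_slope e0).
  have c2 : continuous (fun x : 'rV[R]_n => x0 ord0 i - x ord0 i).
    by move=> x; apply: (@continuousB _ _ _ (cst (x0 ord0 i)));
      [exact: cst_continuous|exact: coord_continuous].
  have c3 : continuous ((soft_cone_slope r e \o (fun x => enorm (x - x0))) \* cst M^-1).
    by move=> x; apply: continuousM; [exact: c1|exact: cst_continuous].
  have : continuous (((soft_cone_slope r e \o (fun x => enorm (x - x0))) \* cst M^-1) \*
      (fun x : 'rV[R]_n => x0 ord0 i - x ord0 i)).
    by move=> x; apply: continuousM; [exact: c3|exact: c2].
  by [].
have dw i x : is_derive x (delta_mx ord0 i) w (G x ord0 i).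
  have d1 := is_deriveZ (M^-1) (is_deriveD (is_derive_cst (1 / beta) x (delta_mx ord0 i))
     (is_derive_soft_cone x0 r e0 x i)).
  have -> : w = M^-1 \*: (cst (1 / beta) + soft_cone x0 r e).
    by apply/funext => y; rewrite /w mulrC.
  apply: (is_derive_eq d1); rewrite add0r !mxE /GRing.scale /=; ring.
(* Two factors at most 1: [soft_pos'], and the quotient of [enorm (x - x0)] by its [soft_abs]. *)
have GM x : enorm (G x) <= M^-1.
  rewrite enormZ enormB normrM normfV (gtr0_norm M0) mulrAC ler_piMl ?invr_ge0 ?(ltW M0)//.
  rewrite normrM normfV (gtr0_norm (soft_abs_gt0 e0 _)) mulrAC -mulrA.
  rewrite mulr_ile1 ?normr_ge0 ?mulr_ge0 ?enorm_ge0 ?invr_ge0 ?(ltW (soft_abs_gt0 e0 _))//.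
    by rewrite ger0_norm ?soft_pos'_ge0// soft_pos'_le1.
  rewrite ler_pdivrMr ?soft_abs_gt0// mul1r.
  by apply: le_trans (le_soft_abs _ _); exact: ler_norm.
have wb x : boundary Omega x -> `|w x| <= (1 / beta + e / 2) / M.
  move=> bx; have /andP[w0 _] := w01 x; rewrite ger0_norm// ler_pM2r ?invr_gt0//.
  rewrite lerD2l; apply: soft_pos_le => //; rewrite subr_le0.
  apply: le_trans (le_soft_abs _ _); apply: le_trans (ler_norm _).
  by rewrite enormB /r -x0R; exact: bdist_le.
have lM0 : 0 <= (1 / beta + e / 2) / M by rewrite divr_ge0 ?(ltW M0)// addr_ge0 ?(ltW
  ib0)// divr_ge0// ltW.
apply: (@le_trans _ _ ((1 + beta * (e / 2)) / M)%:E); last first.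
  rewrite lee_fin ler_pM2l; first by rewrite lef_pV2 ?posrE.
  by rewrite ltr_wpDr// mulr_ge0 ?(ltW beta0)// divr_ge0// ltW.
apply: ge_ereal_inf.
exists (maxe (Linfty_norm Omega (fun x => enorm (G x))) (beta%:E * Linfty_norm_boundary
  Omega w)%E).
  exists w, G, w; split => //.
  - split; first exact: continuous_Linfty.
      by move=> i; exact: continuous_Linfty.
    exact: smooth_weak_gradient.
  - exists w; split=> //; first exact: continuous_subspaceT.
    exact: aeW.
  - apply/le_anti/andP; split.
      apply/Linfty_norm_leP => //; apply: aeW => x _.
      by have /andP[w0 w1] := w01 x; rewrite ger0_norm.
    have := Linfty_norm_ge cw Ox0.
    by rewrite /w -/M divff ?gt_eqF// normr1.
rewrite ge_max; apply/andP; split.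
  apply: (@le_trans _ _ (M^-1)%:E).
    apply/Linfty_norm_leP; first by rewrite invr_ge0 ltW.
    by apply: aeW => x _; rewrite ger0_norm ?enorm_ge0.
  rewrite lee_fin ler_peMl ?invr_ge0 ?(ltW M0)// lerDl mulr_ge0 ?(ltW beta0)//.
  by rewrite divr_ge0// ltW.
apply: le_trans (lee_wpmul2l _ (Linfty_norm_boundary_le lM0 wb)) _.
  by rewrite lee_fin ltW.
have -> : (1 + beta * (e / 2)) / M = beta * ((1 / beta + e / 2) / M).
  by field; rewrite !gt_eqF.
by rewrite EFinM.
Qed.

Lemma Lambda_infty_le (beta : R) : 0 < beta ->
  (Lambda_infty Omega beta <= (1 / (1 / beta + inradius Omega))%:E)%E.
Proof.
move=> beta0.
have n0 : (0 < n)%N by apply: ltn_trans n_gt1.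
have [x0 Ox0 x0R] := inradius_attained Omega_open Omega_bounded Omega0 n0.
have r0 : 0 < inradius Omega by rewrite -x0R; exact: bdist_gt0.
set r := inradius Omega in r0 *.
have ib0 : 0 < 1 / beta by rewrite divr_gt0.
pose b := 1 / beta + r; have b0 : 0 < b by rewrite addr_gt0.
pose g (e : R) := (1 + beta * (e / 2)) / (1 / beta + r - e).
have cg : g e @[e --> 0^'+] --> 1 / b.
  have -> : 1 / b = g 0 by rewrite /g mul0r mulr0 addr0 subr0.
  apply: cvg_at_right_filter; rewrite /g; apply: cvgM.
    by apply: cvgD; [exact: cvg_cst|apply: cvgMl_tmp; apply: cvgMr_tmp; exact: cvg_id].
  apply: cvgV; first by rewrite subr0 gt_eqF.
  by apply: cvgB; [exact: cvg_cst|exact: cvg_id].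
have Ege0 : (0 <= Lambda_infty Omega beta)%E.
  apply: le_ereal_inf_tmp => _ [w [G [T [_ _ _ ->]]]].
  by rewrite le_max Linfty_norm_ge0.
(* The approximate bound at [e = r / 2] gives finiteness, so the limit can be taken among real
   numbers. *)
have Efin : Lambda_infty Omega beta \is a fin_num.
  rewrite ge0_fin_numE//; apply: le_lt_trans (Lambda_infty_le_approx beta0 (e := r / 2) _)
    _.
    by apply/andP; split; rewrite -/r; lra.
  exact: ltry.
rewrite -(fineK Efin) lee_fin; apply: (cvgr_to_ge cg).
near=> e.
have er : 0 < e < r by apply/andP; split; near: e;
  [exact: nbhs_right_gt|exact: nbhs_right_lt].
rewrite -lee_fin fineK//; exact: Lambda_infty_le_approx.
Unshelve. all: by end_near. Qed.

End upper_bound.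

(** * Equality of the two bounds, and the minimum over [Omega] *)

Unset Implicit Arguments.

Theorem lemma3p4 (R : realType) (n : nat) (hn : (2 <= n)%N)
    (Omega : set 'rV[R]_n) (Omega0 : Omega !=set0)
    (Omega_open : open Omega) (Omega_bounded : bounded_set Omega)
    (Omega_lip : lipschitz_boundary Omega)
    (beta : R) (beta_gt0 : 0 < beta) :
  exists m : R,
    [/\ Lambda_infty Omega beta = m%:E,
        is_minimum [set 1 / (1 / beta + bdist Omega x0) | x0 in Omega] m &
        m = 1 / (1 / beta + inradius Omega)].
Proof.
case: n hn Omega Omega0 Omega_open Omega_bounded Omega_lip => [//|[//|k]] _ D D0 oD bD lD.
have [x0 Dx0 x0R] := inradius_attained oD bD D0 (ltn0Sn _).
have ib0 : 0 < 1 / beta by rewrite divr_gt0.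
exists (1 / (1 / beta + inradius D)); split => //.
  apply/le_anti/andP; split; first exact: Lambda_infty_le.
  exact: Lambda_infty_ge.
(* The quotient decreases with the distance to the boundary, so an incentre [x0] minimizes it. *)
split; first by exists x0; rewrite ?x0R.
move=> _ [x Dx <-]; rewrite !div1r lef_pV2 ?posrE.
- by rewrite lerD2l; exact: bdist_le_inradius.
- by rewrite ltr_pwDl ?invr_gt0// -x0R bdist_ge0.
- by rewrite ltr_pwDl ?invr_gt0// bdist_ge0.
Qed.
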